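(* Let $k>2$. Let $\Psi$ be a transformation which preserves the form $$v=x^k+G(x,u),\qquad G(x,u)=\sum_{j=0}^\infty X_j(u)x^j\ \text{ with only terms of weight greater than } k,$$ and the normal form conditions $X_0=X_{k-1}=X_k=X_{2k-1}=0$; that is, $\Psi$ is an invertible (formal) holomorphic transformation fixing the origin that takes a hypersurface of this form satisfying these conditions to another hypersurface of this form satisfying these conditions. Then $\Psi$ is a dilation $$z^*=\delta z,\qquad w^*=\delta^kw,\qquad\delta\in\mathbb R^* .$$
   Context: Coordinates in $\mathbb C^2$ are $(z,w)$ with $z=x+iy$, $w=u+iv$ (and similarly with stars). The variables $z,x,y$ have weight $1$ and $w,u$ have weight $k$. Power series are allowed to be formal. Hypersurfaces of the displayed form (defining equation independent of $y$) are those admitting a nontransversal infinitesimal CR automorphism, written in coordinates in which that vector field is straightened.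
   Formalization: If the source hypersurface is formally equivalent to v = x^k, Ψ is also assumed to carry the straightened field ∂/∂y to a real multiple of ∂/∂y; without this the claim fails, as v = x^k admits other nontransversal fields that can be straightened. *)

(* Defs.v *)
From mathcomp Require Import all_boot all_order all_algebra.
From mathcomp Require Import reals mpoly complex.

Set Implicit Arguments.
Unset Strict Implicit.
Unset Printing Implicit Defensive.

Import GRing.Theory.
Local Open Scope ring_scope.

(* A formal power series in n variables over K, given by its coefficients. *)
Definition fps (n : nat) (K : nzRingType) : Type := 'X_{1..n} -> K.

Definition fps_trunc (n : nat) (K : nzRingType) (a : fps n K) (N : nat) :
    {mpoly K[n]} :=
  \sum_(m : 'X_{1..n < N.+1}) a m *: 'X_[m].

(* Substitution a(b_0, ..., b_(n-1)).  It is only used when every b_i has zero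
   constant term; then the coefficients of total degree d depend only on the
   terms of a and of the b_i of degree at most d, so that truncating at degree
   d is exact. *)
Definition fps_comp (n p : nat) (K : comNzRingType)
    (a : fps n K) (b : 'I_n -> fps p K) : fps p K :=
  fun m => (fps_trunc a (mdeg m) \mPo
            [tuple fps_trunc (b i) (mdeg m) | i < n])@_m.

Definition fps_var (n : nat) (K : nzRingType) (i : 'I_n) : fps n K :=
  fun m => (m == U_(i)%MM)%:R.

Definition fps_const (n : nat) (K : nzRingType) (c : K) : fps n K :=
  fun m => if m == 0%MM then c else 0.

Definition fps_scale (n : nat) (K : nzRingType) (c : K) (a : fps n K) :
    fps n K := fun m => c * a m.

Definition fps_deriv (n : nat) (K : nzRingType) (i : 'I_n) (a : fps n K) :
    fps n K := fun m => a (m + U_(i))%MM *+ (m i).+1.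

(* Indices of the variables: (z, w) in C^2, (x, u) in the right-hand side of a
   defining equation, (x, y, u) for the parameters on a hypersurface. *)
Definition iz : 'I_2 := @Ordinal 2 0 isT.
Definition iw : 'I_2 := @Ordinal 2 1 isT.
Definition jx : 'I_2 := @Ordinal 2 0 isT.
Definition ju : 'I_2 := @Ordinal 2 1 isT.
Definition px : 'I_3 := @Ordinal 3 0 isT.
Definition py : 'I_3 := @Ordinal 3 1 isT.
Definition pu : 'I_3 := @Ordinal 3 2 isT.

Definition pair2 (T : Type) (a b : T) : 'I_2 -> T :=
  fun i => if i == ord0 then a else b.

(* A formal holomorphic transformation, as the pair of its components: Psi iz
   is the new first coordinate z*, Psi iw the new second coordinate w*. *)
Definition fmap2 (R : realType) : Type := 'I_2 -> fps 2 R[i].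

Definition fixes_origin (R : realType) (Psi : fmap2 R) : Prop :=
  forall i, Psi i 0%MM = 0.

Definition invertible_map (R : realType) (Psi : fmap2 R) : Prop :=
  exists Phi : fmap2 R,
    [/\ fixes_origin Phi,
        forall i, fps_comp (Psi i) Phi =1 fps_var R[i] i
      & forall i, fps_comp (Phi i) Psi =1 fps_var R[i] i].

Definition dilation (R : realType) (k : nat) (delta : R) : fmap2 R :=
  pair2 (fps_scale (delta%:C)%C (fps_var R[i] iz))
        (fps_scale ((delta ^+ k)%:C)%C (fps_var R[i] iw)).

(* The series x^k + G(x, u). *)
Definition rhs (R : realType) (k : nat) (G : fps 2 R) : fps 2 R :=
  fun m => (m == (U_(jx) *+ k)%MM)%:R + G m.

(* The coefficient X_j(u) of x^j in G(x, u), as the sequence of its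
   coefficients in u. *)
Definition xcoef (R : realType) (G : fps 2 R) (j : nat) : nat -> R :=
  fun l => G (U_(jx) *+ j + U_(ju) *+ l)%MM.

Definition weight_gt (R : realType) (k : nat) (G : fps 2 R) : Prop :=
  forall m : 'X_{1..2}, G m != 0 -> (k < m jx + k * m ju)%N.

Definition normal_form (R : realType) (k : nat) (G : fps 2 R) : Prop :=
  [/\ xcoef G 0 =1 fun=> 0, xcoef G k.-1 =1 fun=> 0,
      xcoef G k =1 fun=> 0 & xcoef G (2 * k).-1 =1 fun=> 0].

(* The generic point (z, w) = (x + i y, u + i Q(x, u)) of the hypersurface
   v = Q(x, u), as series in the real variables x, y, u. *)
Definition generic_point (R : realType) (Q : fps 2 R) : 'I_2 -> fps 3 R[i] :=
  pair2
    (fun m => (fps_var R px m +i* fps_var R py m)%C)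
    (fun m => (fps_var R pu m +i*
               fps_comp Q (pair2 (fps_var R px) (fps_var R pu)) m)%C).

Definition fps_Re (n : nat) (R : realType) (a : fps n R[i]) : fps n R :=
  fun m => complex.Re (a m).
Definition fps_Im (n : nat) (R : realType) (a : fps n R[i]) : fps n R :=
  fun m => complex.Im (a m).

(* Psi takes the hypersurface v = Q to the hypersurface v = Q': the image of
   the generic point of the former satisfies the equation of the latter,
   identically in x, y, u. *)
Definition takes (R : realType) (Psi : fmap2 R) (Q Q' : fps 2 R) : Prop :=
  let zs := fps_comp (Psi iz) (generic_point Q) in
  let ws := fps_comp (Psi iw) (generic_point Q) in
  fps_Im ws =1 fps_comp Q' (pair2 (fps_Re zs) (fps_Re ws)).

Definition equivalent (R : realType) (Q Q' : fps 2 R) : Prop :=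
  exists Phi : fmap2 R,
    [/\ fixes_origin Phi, invertible_map Phi & takes Phi Q Q'].

(* The straightened infinitesimal CR automorphism of v = Q(x, u) is
   d/dy = 2 Re (i d/dz).  With f = Psi iz and g = Psi iw, its image under Psi
   has components (i df/dz, i dg/dz), so it is c d/dy in the new coordinates
   iff df/dz = c and dg/dz = 0.  The factor c is real because infinitesimal CR
   automorphisms are only closed under real multiples. *)
Definition respects_dy (R : realType) (Psi : fmap2 R) : Prop :=
  exists c : R,
    fps_deriv iz (Psi iz) =1 fps_const (c%:C)%C /\
    fps_deriv iz (Psi iw) =1 fps_const 0.

(* Main.v *)
Require Import Defs.
From HB Require Import structures.
From mathcomp Require Import all_boot all_order all_algebra.
From mathcomp Require Import boolp reals mpoly complex.
From mathcomp Require Import ring lra zify.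
Set Implicit Arguments.
Unset Strict Implicit.
Unset Printing Implicit Defensive.
Import GRing.Theory Num.Theory Order.TTheory.
Local Open Scope ring_scope.

(** Give z, x, y weight 1 and w, u weight k, and write Psi = (f, g). At the point
    z = x + iy, w = u + i (x^k + G(x, u)) of the source, the hypothesis is the
    identity Im g = (Re f)^k + G'(Re f, Re g) in x, y, u, and it is compared
    weight by weight.

    Lowest weights (leading_terms). The condition X_0 = 0 on the target forbids
    terms of weight below k in g. In weight k the identity reads
    Im (beta w + gamma z^k) = (Re alpha z)^k on v = x^k. For k > 2 its first four
    coefficients in y give alpha real, beta = alpha^k and gamma = 0, so Psi
    starts with the dilation of ratio alpha.

    Higher weights (linearize, kernel_coef, normal_form_step). Let (f1, g1) be the
    difference of Psi and this dilation, starting in weights N + 1 and N + k. In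
    weight N + k it satisfies on the model v = x^k the linear equation
    Im g1 - k alpha^(k-1) x^(k-1) Re f1 = a function of x and u. Polarize it, with z
    and its conjugate as independent variables, and restrict it to the Segre set
    where the conjugate of w is 0 and w = 2i x^k. The terms of f1 and g1 then only
    have exponents of x congruent to 0 or -1 modulo k, while the conjugate terms
    become multiples of powers of 2x - z. The coefficients of x and x^(k+1) leave
    only powers of w in (f1, g1), and the vanishing of X_0, X_(k-1), X_k, X_(2k-1)
    removes these. For N = 1 there is one exception: f1 may start with phi z^2
    where phi is imaginary, and then g1 starts with 2k alpha^(k-1) phi z w
    (first_step).

    The exception (field_exists, tangency, eigen_exists, eigen_zero, linearized).
    If phi is not 0, the holomorphic field E with E f = alpha, E g = 0 is, up to
    a real factor, the pullback of the field d/dz of the target, so Re (iE) is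
    tangent to the source. Hence so is Re (i (E - d/dz)), which vanishes at the
    origin: E - d/dz = lambda (z d/dz + k w d/dw) + terms of higher weight, with
    lambda imaginary and nonzero. Corrections of z and w only involve weights above
    1 and k, so there is no resonance, and there are eigenfunctions z + ... and
    w + ... (Poincare-Dulac). In these coordinates the source is invariant under
    dilations, so it is the model v = x^k. Then Psi respects d/dy by hypothesis,
    so that f has no quadratic term, and phi = 0 after all.

    The bookkeeping takes place in the rings of formal power series, filtered by
    weighted order. Inverses, inverse transformations and eigenfunctions all come
    from one contraction principle, fps_fixpoint. *)

(** * The ring of formal power series *)

Lemma fps_truncE n (K : nzRingType) (a : fps n K) N m :
  (fps_trunc a N)@_m = if (mdeg m <= N)%N then a m else 0.
Proof.
rewrite /fps_trunc; case: leqP => h; first by rewrite mcoeff_mpoly.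
rewrite raddf_sum big1 //= => i _; rewrite mcoeffZ mcoeffX.
case: eqP => [e|]; last by rewrite mulr0.
by have := bmdeg i; rewrite e ltnS leqNgt h.
Qed.

HB.instance Definition _ n (K : nzRingType) := gen_eqMixin (fps n K).
HB.instance Definition _ n (K : nzRingType) := gen_choiceMixin (fps n K).

HB.lock Definition fps_mul (n : nat) (K : comNzRingType) (a b : fps n K) : fps n K :=
  fun m => (fps_trunc a (mdeg m) * fps_trunc b (mdeg m))@_m.

Section Ring.
Variables (n : nat) (K : comNzRingType).
Implicit Types a b c : fps n K.

Lemma fpsP a b : (a =1 b) <-> a = b.
Proof. by split=> [/funext|->]. Qed.

Definition fps_add a b : fps n K := fun m => a m + b m.
Definition fps_opp a : fps n K := fun m => - a m.
Definition fps_zero : fps n K := fun=> 0.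

Fact fps_addA : associative fps_add.
Proof. by move=> a b c; apply: funext => m; apply: addrA. Qed.
Fact fps_addC : commutative fps_add.
Proof. by move=> a b; apply: funext => m; apply: addrC. Qed.
Fact fps_add0 : left_id fps_zero fps_add.
Proof. by move=> a; apply: funext => m; apply: add0r. Qed.
Fact fps_addN : left_inverse fps_zero fps_opp fps_add.
Proof. by move=> a; apply: funext => m; apply: addNr. Qed.

HB.instance Definition _ := GRing.isZmodule.Build (fps n K)
  fps_addA fps_addC fps_add0 fps_addN.

Lemma fpsDE a b m : (a + b) m = a m + b m. Proof. by []. Qed.
Lemma fpsNE a m : (- a) m = - a m. Proof. by []. Qed.
Lemma fpsBE a b m : (a - b) m = a m - b m. Proof. by []. Qed.
Lemma fps0E m : (0 : fps n K) m = 0. Proof. by []. Qed.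

(** The reason why truncation is harmless: a coefficient of a product of degree d only
    sees the coefficients of the factors of degree at most d. *)
Lemma mcoeffM_congr (p p' q q' : {mpoly K[n]}) m :
  (forall m', (mdeg m' <= mdeg m)%N -> p@_m' = p'@_m') ->
  (forall m', (mdeg m' <= mdeg m)%N -> q@_m' = q'@_m') ->
  (p * q)@_m = (p' * q')@_m.
Proof.
move=> hp hq; rewrite !mcoeffM; apply: eq_bigr => -[k1 k2] /= /eqP e.
have := congr1 mdeg e; rewrite mdegD => e'.
by rewrite hp ?hq //; [rewrite [leqRHS]e' leq_addl | rewrite [leqRHS]e' leq_addr].
Qed.

Lemma fps_mulE a b N m : (mdeg m <= N)%N ->
  fps_mul a b m = (fps_trunc a N * fps_trunc b N)@_m.
Proof.
move=> h; rewrite fps_mul.unlock; apply: mcoeffM_congr => m' h'; rewrite !fps_truncE h';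
by rewrite (leq_trans h' h).
Qed.

Fact fps_mulA : associative (@fps_mul n K).
Proof.
move=> a b c; apply: funext => m; rewrite ![fps_mul _ _ m](fps_mulE _ _ (leqnn _)).
transitivity ((fps_trunc a (mdeg m) * (fps_trunc b (mdeg m) * fps_trunc c (mdeg m)))@_m).
  by apply: mcoeffM_congr => // m' h; rewrite fps_truncE h (fps_mulE _ _ h).
rewrite mulrA.
by apply: mcoeffM_congr => // m' h; rewrite fps_truncE h (fps_mulE _ _ h).
Qed.

Fact fps_mulC : commutative (@fps_mul n K).
Proof. by move=> a b; apply: funext => m; rewrite fps_mul.unlock mulrC. Qed.

Fact fps_mul1 : left_id (@fps_const n K 1) (@fps_mul n K).
Proof.
move=> a; apply: funext => m; rewrite fps_mul.unlock.
transitivity ((1 * fps_trunc a (mdeg m))@_m); last by rewrite mul1r fps_truncE leqnn.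
apply: mcoeffM_congr => // m' h; rewrite fps_truncE h mcoeff1 /fps_const.
by case: eqP.
Qed.

Fact fps_mulDl : left_distributive (@fps_mul n K) +%R.
Proof.
move=> a b c; apply: funext => m; rewrite fpsDE fps_mul.unlock -mcoeffD -mulrDl.
apply: mcoeffM_congr => // m' h; rewrite mcoeffD !fps_truncE h; exact: fpsDE.
Qed.

Fact fps_1neq0 : @fps_const n K 1 != 0 :> fps n K.
Proof.
apply/eqP => /(congr1 (fun a : fps n K => a 0%MM)); rewrite /fps_const eqxx => /eqP.
by rewrite [X in _ == X]fps0E oner_eq0.
Qed.

HB.instance Definition _ := GRing.Zmodule_isComNzRing.Build (fps n K)
  fps_mulA fps_mulC fps_mul1 fps_mulDl fps_1neq0.

Lemma fps1E m : (1 : fps n K) m = (m == 0%MM)%:R.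
Proof. by rewrite -[LHS]/(@fps_const n K 1 m) /fps_const; case: eqP. Qed.

Lemma fpsME a b N m : (mdeg m <= N)%N ->
  (a * b) m = (fps_trunc a N * fps_trunc b N)@_m.
Proof. exact: fps_mulE. Qed.

End Ring.

(** * Constants and monomials *)

HB.lock Definition fpsC (n : nat) (K : comNzRingType) (c : K) : fps n K := fps_const c.
HB.lock Definition mon (n : nat) (K : comNzRingType) (m : 'X_{1..n}) : fps n K :=
  fun m' => (m' == m)%:R.
Arguments fpsC {n K}.
Arguments mon {n K}.

Section Const.
Variables (n : nat) (K : comNzRingType).
Implicit Types (a b : fps n K) (c : K).
Local Notation fpsC := (@fpsC n K).
Local Notation mon := (@mon n K).

Lemma fpsME_eq0 a b m :
  (forall m1 m2, m = (m1 + m2)%MM -> a m1 = 0 \/ b m2 = 0) -> (a * b) m = 0.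
Proof.
move=> h; rewrite (fpsME _ _ (leqnn _)) mcoeffM big1 // => -[k1 k2] /= /eqP e.
rewrite !fps_truncE; case: ifP; case: ifP; rewrite ?(mulr0, mul0r) // => _ _.
by have [->|->] := h _ _ e; rewrite ?(mulr0, mul0r).
Qed.

Definition fps_of_mpoly (p : {mpoly K[n]}) : fps n K := fun m => p@_m.

Fact fps_of_mpoly_additive : additive fps_of_mpoly.
Proof. by move=> p q; apply/fpsP => m; apply: mcoeffB. Qed.
Fact fps_of_mpoly_multiplicative : multiplicative fps_of_mpoly.
Proof.
split=> [p q|]; apply/fpsP => m; last by rewrite fps1E -mcoeff1.
rewrite (fpsME _ _ (leqnn _)); apply: mcoeffM_congr => m' h;
by rewrite fps_truncE h.
Qed.
HB.instance Definition _ := GRing.isAdditive.Build _ _ _ fps_of_mpoly_additive.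
HB.instance Definition _ := GRing.isMultiplicative.Build _ _ _ fps_of_mpoly_multiplicative.

Lemma fpsC_mpoly c : fpsC c = fps_of_mpoly c%:MP.
Proof.
apply/fpsP => m; rewrite fpsC.unlock /fps_const /fps_of_mpoly mcoeffC.
by case: eqP; rewrite ?mulr1 ?mulr0.
Qed.

Fact fpsC_additive : additive fpsC.
Proof. by move=> p q; rewrite !fpsC_mpoly mpolyCB rmorphB. Qed.
Fact fpsC_multiplicative : multiplicative fpsC.
Proof. by split=> [p q|]; rewrite !fpsC_mpoly ?mpolyCM ?mpolyC1 ?rmorph1 // rmorphM. Qed.
HB.instance Definition _ := GRing.isAdditive.Build _ _ _ fpsC_additive.
HB.instance Definition _ := GRing.isMultiplicative.Build _ _ _ fpsC_multiplicative.

Lemma fpsCE c m : fpsC c m = if m == 0%MM then c else 0.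
Proof. by rewrite fpsC.unlock. Qed.

Lemma fpsCM c a m : (fpsC c * a) m = c * a m.
Proof.
rewrite (fpsME _ _ (leqnn _)).
transitivity ((c%:MP * fps_trunc a (mdeg m))@_m); last first.
  by rewrite mcoeffCM fps_truncE leqnn.
apply: mcoeffM_congr => // m' h; rewrite fps_truncE h fpsC_mpoly //.
Qed.

Lemma monE (m m' : 'X_{1..n}) : (mon m : fps n K) m' = (m' == m)%:R.
Proof. by rewrite mon.unlock. Qed.

Lemma mon_mpoly m : mon m = fps_of_mpoly 'X_[m].
Proof. by apply/fpsP => m'; rewrite monE /fps_of_mpoly mcoeffX eq_sym. Qed.

Lemma monD m1 m2 : mon (m1 + m2)%MM = mon m1 * mon m2.
Proof. by rewrite !mon_mpoly mpolyXD rmorphM. Qed.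
Lemma monX m k : mon (m *+ k)%MM = mon m ^+ k.
Proof. by rewrite !mon_mpoly -mpolyXn rmorphXn. Qed.
Definition var i : fps n K := mon U_(i)%MM.
Lemma varE i : var i = mon U_(i)%MM. Proof. by []. Qed.
Lemma fps_varE i : fps_var K i = var i.
Proof. by apply/fpsP => m; rewrite varE monE. Qed.

Lemma mon_prod m : mon m = \prod_i var i ^+ m i.
Proof.
rewrite mon_mpoly mpolyXE_id rmorph_prod; apply: eq_bigr => i _.
by rewrite rmorphXn varE mon_mpoly.
Qed.

Lemma fps_of_mpolyE p :
  fps_of_mpoly p = \sum_(m <- msupp p) fpsC p@_m * mon m.
Proof.
rewrite {1}(mpolyE p) rmorph_sum; apply: eq_bigr => m _.
by rewrite -mul_mpolyC rmorphM fpsC_mpoly mon_mpoly.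
Qed.

Definition cst_coef a : K := a 0%MM.
Fact cst_coef_additive : additive cst_coef.
Proof. by []. Qed.
Fact cst_coef_multiplicative : multiplicative cst_coef.
Proof.
split=> [a b|]; last by rewrite /cst_coef fps1E eqxx.
rewrite /cst_coef (fpsME _ _ (leqnn _)).
rewrite -[LHS]/(mcoeff 0 _) rmorphM /=.
by rewrite !fps_truncE mdeg0.
Qed.
HB.instance Definition _ := GRing.isAdditive.Build _ _ _ cst_coef_additive.
HB.instance Definition _ := GRing.isMultiplicative.Build _ _ _ cst_coef_multiplicative.

End Const.
Arguments var {n K}.

(** * Weighted order of vanishing *)

Section Weight.
Variables (n : nat).
Implicit Types (w : 'I_n -> nat) (m : 'X_{1..n}).

Definition mwt w m := (\sum_i w i * m i)%N.

Lemma mwtD w m1 m2 : mwt w (m1 + m2)%MM = (mwt w m1 + mwt w m2)%N.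
Proof. by rewrite /mwt -big_split; apply: eq_bigr => i _; rewrite mnmDE mulnDr. Qed.
Lemma mwt0 w : mwt w 0%MM = 0%N.
Proof. by rewrite /mwt big1 // => i _; rewrite mnm0E muln0. Qed.
Lemma mwtU w i : mwt w U_(i)%MM = w i.
Proof.
rewrite /mwt (bigD1 i) //= mnm1E eqxx muln1 big1 ?addn0 // => j h.
by rewrite mnm1E eq_sym (negbTE h) muln0.
Qed.
Lemma mwtMn w m k : mwt w (m *+ k)%MM = (mwt w m * k)%N.
Proof. by rewrite /mwt big_distrl; apply: eq_bigr => i _; rewrite mulmnE mulnA. Qed.

Definition wdeg : 'I_n -> nat := fun=> 1%N.
Lemma mwt_deg m : mwt wdeg m = mdeg m.
Proof. by rewrite mdegE; apply: eq_bigr => i _; rewrite mul1n. Qed.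

End Weight.

Section Vanish.
Variables (n : nat) (K : comNzRingType).
Implicit Types (w : 'I_n -> nat) (m : 'X_{1..n}) (a b c : fps n K).

(** The filtration of the series by weighted order. The weights w vary: besides the
    weights 1 and k of the problem, unequal or zero weights are used to single out the terms
    without a given variable. *)
Definition vanish w N a := forall m, (mwt w m < N)%N -> a m = 0.

Lemma vanish0 w N : vanish w N 0. Proof. by []. Qed.
Lemma vanishW w M N a : (N <= M)%N -> vanish w M a -> vanish w N a.
Proof. by move=> h H m hm; apply: H; apply: leq_trans h. Qed.
Lemma vanishD w N a b : vanish w N a -> vanish w N b -> vanish w N (a + b).
Proof. by move=> ha hb m h; rewrite fpsDE ha ?hb ?addr0. Qed.
Lemma vanishN w N a : vanish w N a -> vanish w N (- a).
Proof. by move=> ha m h; rewrite fpsNE ha ?oppr0. Qed.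
Lemma vanishB w N a b : vanish w N a -> vanish w N b -> vanish w N (a - b).
Proof. by move=> ha /vanishN; apply: vanishD. Qed.
Lemma vanish_sum w N I (r : seq I) (P : pred I) (F : I -> fps n K) :
  (forall i, P i -> vanish w N (F i)) -> vanish w N (\sum_(i <- r | P i) F i).
Proof. by move=> h; elim/big_ind: _ => // *; exact: vanishD. Qed.
Lemma vanishM w M N a b : vanish w M a -> vanish w N b -> vanish w (M + N) (a * b).
Proof.
move=> ha hb m h; apply: fpsME_eq0 => m1 m2 e.
have [h1|h1] := ltnP (mwt w m1) M; first by left; apply: ha.
have [h2|h2] := ltnP (mwt w m2) N; first by right; apply: hb.
by move: h; rewrite e mwtD ltnNge leq_add.
Qed.
Lemma vanishMl w N a b : vanish w N b -> vanish w N (a * b).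
Proof. by move=> h; rewrite -[N]add0n; apply: vanishM. Qed.
Lemma vanishMr w N a b : vanish w N a -> vanish w N (a * b).
Proof. by rewrite mulrC; apply: vanishMl. Qed.
Lemma vanishX w N a k : vanish w N a -> vanish w (N * k) (a ^+ k).
Proof.
move=> h; elim: k => [|k IH]; first by rewrite muln0.
by rewrite exprS mulnS; apply: vanishM.
Qed.
Lemma vanish_mon w m : vanish w (mwt w m) (mon m : fps n K).
Proof. by move=> m' h; rewrite monE; case: eqP h => // ->; rewrite ltnn. Qed.
Lemma vanish_var w i : vanish w (w i) (var i : fps n K).
Proof. by rewrite -{1}(mwtU w i); apply: vanish_mon. Qed.
Lemma vanish_all w a : (forall N, vanish w N a) -> a = 0.
Proof. by move=> h; apply/fpsP => m; apply: (h (mwt w m).+1). Qed.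
Lemma vanish_deg1 a : vanish (@wdeg n) 1 a <-> a 0%MM = 0.
Proof.
split=> [h|h m]; first by apply: h; rewrite mwt_deg mdeg0.
by rewrite mwt_deg ltnS leqn0 mdeg_eq0 => /eqP ->.
Qed.
Lemma vanish_pos w N a : (0 < N)%N -> vanish w N a -> a 0%MM = 0.
Proof. by move=> h; apply; rewrite mwt0. Qed.

(** Powers of approximations. A relative error of order d in each factor gives a
    relative error of order d in the product. *)
Lemma vanish_prod w d (I : Type) (v : I -> nat) (r : seq I) (e : I -> nat) (F G : I -> fps n K) :
  (forall i, vanish w (v i) (F i)) -> (forall i, vanish w (v i) (G i)) ->
  (forall i, vanish w (v i + d) (F i - G i)) ->
  let s := (\sum_(i <- r) v i * e i)%N in
  [/\ vanish w s (\prod_(i <- r) F i ^+ e i), vanish w s (\prod_(i <- r) G i ^+ e i)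
    & vanish w (s + d) (\prod_(i <- r) F i ^+ e i - \prod_(i <- r) G i ^+ e i)].
Proof.
move=> hF hG hFG /=.
have step M N a a' b b' : [/\ vanish w M a, vanish w M a' & vanish w (M + d) (a - a')] ->
  [/\ vanish w N b, vanish w N b' & vanish w (N + d) (b - b')] ->
  [/\ vanish w (M + N) (a * b), vanish w (M + N) (a' * b')
     & vanish w (M + N + d) (a * b - a' * b')].
  move=> [h1 h2 h3] [g1 g2 g3]; split; try exact: vanishM.
  have -> : a * b - a' * b' = a * (b - b') + (a - a') * b' by ring.
  apply: vanishD; first by rewrite -addnA; apply: vanishM.
  by rewrite addnAC; apply: vanishM.
elim: r => [|i r IH]; first by rewrite !big_nil subrr; split => //; exact: vanish0.
rewrite !big_cons; refine (step _ _ _ _ _ _ _ IH).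
elim: (e i) => [|k IHk]; first by rewrite muln0 !expr0 subrr; split => //; exact: vanish0.
by rewrite mulnS !exprS; apply: step.
Qed.
End Vanish.

(** * Substitution *)

Section Eval.
Variables (n p : nat) (K : comNzRingType).
Implicit Types (b : 'I_n -> fps p K) (q : {mpoly K[n]}).

(** Substitution of series into a polynomial. All facts on substitution are proved here
    and extended to series by truncation. *)
Definition ev b : {mpoly K[n]} -> fps p K := mmap (@fpsC p K) b.
HB.instance Definition _ b := GRing.RMorphism.on (ev b).

Lemma evX b m : ev b 'X_[m] = mmap1 b m. Proof. exact: mmapX. Qed.
Lemma evC b c : ev b c%:MP = fpsC c. Proof. exact: mmapC. Qed.

Lemma ev_vanish b v w N q :
  (forall i, vanish v (w i) (b i)) -> (forall m, (mwt w m < N)%N -> q@_m = 0) ->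
  vanish v N (ev b q).
Proof.
move=> hb hq; rewrite /ev /mmap; apply: vanish_sum => m _.
have [/hq ->|h] := ltnP (mwt w m) N; first by rewrite rmorph0 mul0r.
apply: vanishMl; apply: vanishW h _.
have [] // := @vanish_prod p K v 0 _ w (index_enum 'I_n) m b b hb hb.
by move=> i; rewrite subrr.
Qed.

Lemma ev_congr b b' v w N d q :
  (forall i, vanish v (w i) (b i)) -> (forall i, vanish v (w i) (b' i)) ->
  (forall i, vanish v (w i + d) (b i - b' i)) ->
  (forall m, (mwt w m < N)%N -> q@_m = 0) ->
  vanish v (N + d) (ev b q - ev b' q).
Proof.
move=> hb hb' hbb hq; rewrite /ev /mmap -sumrB; apply: vanish_sum => m _.
have [/hq ->|h] := ltnP (mwt w m) N; first by rewrite rmorph0 !mul0r subrr.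
rewrite -mulrBr; apply: vanishMl; apply: (@vanishW _ _ _ (mwt w m + d)).
  by rewrite leq_add2r.
by have [] // := @vanish_prod p K v d _ w (index_enum 'I_n) m b b' hb hb'.
Qed.

End Eval.

HB.lock Definition fsubst (n p : nat) (K : comNzRingType)
  (a : fps n K) (b : 'I_n -> fps p K) : fps p K := fps_comp a b.

Section Comp.
Variables (n p : nat) (K : comNzRingType).
Implicit Types (a : fps n K) (b : 'I_n -> fps p K) (q : {mpoly K[n]}).

Lemma trunc_vanish w N D a m : vanish w N a -> (mwt w m < N)%N -> (fps_trunc a D)@_m = 0.
Proof. by move=> h hm; rewrite fps_truncE h //; case: ifP. Qed.

(** Any truncation order from the degree of the coefficient on gives the same value, and the
    inner series need not be truncated. This is what makes fsubst accessible to ring morphisms. *)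
Lemma fsubstE a b N m : (forall i, b i 0%MM = 0) -> (mdeg m <= N)%N ->
  fsubst a b m = ev b (fps_trunc a N) m.
Proof.
rewrite fsubst.unlock => b0 hN; set M := mdeg m.
have b1 i : vanish (@wdeg p) (wdeg i) (b i) by apply/vanish_deg1.
transitivity (ev b (fps_trunc a M) m).
  rewrite /fps_comp -/M.
  pose b' i := fps_of_mpoly (fps_trunc (b i) M).
  transitivity (ev b' (fps_trunc a M) m).
    rewrite -[LHS]/(fps_of_mpoly _ m); congr (_ m).
    rewrite comp_mpolyE rmorph_sum /ev /mmap; apply: eq_bigr => k _.
    rewrite -mul_mpolyC rmorphM rmorph_prod fpsC_mpoly /=.
    have -> : mmap1 b' k = \prod_i fps_of_mpoly (tnth [tuple fps_trunc (b i) M  | i < n] i ^+ k i).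
      by apply: eq_bigr => i _; rewrite rmorphXn tnth_mktuple.
    by [].
  apply/eqP; rewrite -subr_eq0; apply/eqP.
  rewrite -fpsBE; apply: (@ev_congr _ _ _ b' b (@wdeg p) (fun=> 0) 0 M.+1) => //;
    last by rewrite mwt_deg.
  move=> i m'; rewrite mwt_deg add0n ltnS => hm'.
  by rewrite fpsBE /b' /fps_of_mpoly fps_truncE hm' subrr.
apply/eqP; rewrite eq_sym -subr_eq0 -fpsBE -rmorphB; apply/eqP.
apply: (@ev_vanish _ _ _ b (@wdeg p) (@wdeg n) M.+1); last by rewrite mwt_deg.
  exact: b1.
move=> m'; rewrite mwt_deg ltnS => hm'; rewrite mcoeffB !fps_truncE hm'.
by rewrite (leq_trans hm' hN) subrr.
Qed.

Section WithB.
Variable (b : 'I_n -> fps p K).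
Hypothesis b0 : forall i, b i 0%MM = 0.

(** If b_i has at least the weighted order attributed to the variable i, substitution
    does not lower the weighted order. *)
Lemma fsubst_vanish v w N a :
  (forall i, vanish v (w i) (b i)) -> vanish w N a -> vanish v N (fsubst a b).
Proof.
move=> hb ha m h; rewrite (fsubstE _ b0 (leqnn _)).
by apply: (ev_vanish hb) h => m'; apply: trunc_vanish.
Qed.

Fact fsubst_ev q a m : (forall m', (mdeg m' <= mdeg m)%N -> q@_m' = a m') ->
  fsubst a b m = ev b q m.
Proof.
move=> h; rewrite (fsubstE _ b0 (leqnn _)).
apply/eqP; rewrite -subr_eq0 -fpsBE -rmorphB; apply/eqP.
apply: (@ev_vanish _ _ _ b (@wdeg p) (@wdeg n) (mdeg m).+1); last by rewrite mwt_deg.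
  by move=> i; apply/vanish_deg1.
move=> m'; rewrite mwt_deg ltnS => hm'; rewrite mcoeffB fps_truncE hm' h //.
by rewrite subrr.
Qed.

Lemma fsubst_of_mpoly q : fsubst (fps_of_mpoly q) b = ev b q.
Proof. by apply/fpsP => m; apply: fsubst_ev. Qed.

Lemma fsubstB a a' : fsubst (a - a') b = fsubst a b - fsubst a' b.
Proof.
apply/fpsP => m; rewrite fpsBE !(fsubstE _ b0 (leqnn _)) -fpsBE -rmorphB.
rewrite -(fsubstE _ b0 (leqnn _)); apply: fsubst_ev => m' h.
by rewrite mcoeffB !fps_truncE h.
Qed.

Lemma fsubstC c : fsubst (fpsC c) b = fpsC c.
Proof. by rewrite fpsC_mpoly fsubst_of_mpoly evC. Qed.

Lemma fsubstM a a' : fsubst (a * a') b = fsubst a b * fsubst a' b.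
Proof.
apply/fpsP => m; set N := mdeg m.
transitivity (ev b (fps_trunc a N * fps_trunc a' N) m).
  by apply: fsubst_ev => m' h; rewrite (fpsME _ _ h).
rewrite rmorphM !(fpsME _ _ (leqnn (mdeg m))) .
apply: mcoeffM_congr => m' h; rewrite !fps_truncE h; symmetry; exact: fsubstE.
Qed.

End WithB.

(** Substitution as a function of the outer series alone, with the vanishing of the constant
    terms as an argument, so that it can be declared a ring morphism. *)
Definition subst b (b0 : forall i, b i 0%MM = 0) a : fps p K := fsubst a b.
Section Subst.
Variables (b : 'I_n -> fps p K) (b0 : forall i, b i 0%MM = 0).
Fact subst_additive : additive (subst b0). Proof. exact: fsubstB. Qed.
Fact subst_multiplicative : multiplicative (subst b0).
Proof. by split; [exact: fsubstM|have := fsubstC b0 1; rewrite !rmorph1]. Qed.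
HB.instance Definition _ := GRing.isAdditive.Build _ _ _ subst_additive.
HB.instance Definition _ := GRing.isMultiplicative.Build _ _ _ subst_multiplicative.
End Subst.

(** First-order approximation: a relative error d in the inner series raises the
    weighted order by d. *)
Lemma fsubst_congr v w N d b b' a :
  (forall i, b i 0%MM = 0) -> (forall i, b' i 0%MM = 0) ->
  (forall i, vanish v (w i) (b i)) -> (forall i, vanish v (w i) (b' i)) ->
  (forall i, vanish v (w i + d) (b i - b' i)) ->
  vanish w N a ->
  vanish v (N + d) (fsubst a b - fsubst a b').
Proof.
move=> b0 b0' hb hb' hbb ha m h.
rewrite fpsBE (fsubstE _ b0 (leqnn _)) (fsubstE _ b0' (leqnn _)) -fpsBE.
by apply: (ev_congr hb hb' hbb) h => m'; apply: trunc_vanish.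
Qed.

End Comp.

Section CompTheory.
Variables (K : comNzRingType).

Lemma ev_var n (q : {mpoly K[n]}) : ev var q = fps_of_mpoly q.
Proof. by rewrite fps_of_mpolyE; apply: eq_bigr => m _; rewrite mon_prod. Qed.

Lemma fsubst_trunc n p (a : fps n K) (b : 'I_n -> fps p K) N :
  (forall i, b i 0%MM = 0) ->
  vanish (@wdeg p) N.+1 (fsubst a b - ev b (fps_trunc a N)).
Proof.
by move=> b0 m; rewrite mwt_deg ltnS => h; rewrite fpsBE (fsubstE _ b0 h) subrr.
Qed.

Lemma fsubst_var n p (b : 'I_n -> fps p K) i : (forall i, b i 0%MM = 0) ->
  fsubst (var i) b = b i.
Proof. by move=> b0; rewrite varE mon_mpoly fsubst_of_mpoly // evX mmap1U. Qed.

Lemma var0 n i : (var i : fps n K) 0%MM = 0.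
Proof. by rewrite varE monE eq_sym mnm1_eq0. Qed.

Lemma fsubst_id n (a : fps n K) : fsubst a var = a.
Proof.
apply/fpsP => m; rewrite (fsubstE _ (@var0 n) (leqnn _)) ev_var.
by rewrite /fps_of_mpoly fps_truncE leqnn.
Qed.

Lemma fsubst_cst n p (a : fps n K) (b : 'I_n -> fps p K) :
  (forall i, b i 0%MM = 0) -> fsubst a b 0%MM = a 0%MM.
Proof.
move=> b0; have : vanish (@wdeg n) 1 (a - fpsC (a 0%MM)).
  by apply/vanish_deg1; rewrite fpsBE fpsCE eqxx subrr.
move/(fsubst_vanish (v := @wdeg p) b0) => h.
have {h} : fsubst (a - fpsC (a 0%MM)) b 0%MM = 0.
  by apply/vanish_deg1/h => i; apply/vanish_deg1.
by rewrite fsubstB // fsubstC // fpsBE fpsCE eqxx => /subr0_eq.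
Qed.

Lemma ev_morph n p p' (phi : {rmorphism fps p K -> fps p' K})
    (b : 'I_n -> fps p K) (q : {mpoly K[n]}) :
  (forall c, phi (fpsC c) = fpsC c) -> phi (ev b q) = ev (phi \o b) q.
Proof.
move=> hC; rewrite /ev /mmap rmorph_sum; apply: eq_bigr => m _.
rewrite rmorphM hC rmorph_prod; congr (_ * _); apply: eq_bigr => i _.
by rewrite rmorphXn.
Qed.

(** Modulo high degree a is a polynomial, and on polynomials this says that substitution is a
    ring morphism. *)
Lemma fsubstA n p p' (a : fps n K) (b : 'I_n -> fps p K) (c : 'I_p -> fps p' K) :
  (forall i, b i 0%MM = 0) -> (forall i, c i 0%MM = 0) ->
  fsubst (fsubst a b) c = fsubst a (fun i => fsubst (b i) c).
Proof.
move=> b0 c0; apply/fpsP => m; set N := mdeg m.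
have d0 i : fsubst (b i) c 0%MM = 0 by rewrite fsubst_cst.
rewrite (fsubstE _ d0 (leqnn _)) -/N.
have := fsubst_vanish (v := @wdeg p') (w := @wdeg p) c0 _ (fsubst_trunc (N := N) a b0).
rewrite fsubstB // => /(_ _ m); rewrite mwt_deg ltnS leqnn fpsBE.
move=> h; apply/eqP; rewrite -subr_eq0; apply/eqP.
have e := @ev_morph n p p' (subst c0) b (fps_trunc a N) (fsubstC c0).
by rewrite -[ev (fun i => _) _]e; apply: h => // i; apply/vanish_deg1.
Qed.

End CompTheory.

(** * Maps on coefficients *)

Section MapCoef.
Variables (K L : comNzRingType) (theta : {rmorphism K -> L}).

Definition fps_map n (a : fps n K) : fps n L := fun m => theta (a m).

Lemma trunc_map n (a : fps n K) N :
  fps_trunc (fps_map a) N = map_mpoly theta (fps_trunc a N).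
Proof.
apply/mpolyP => m; rewrite mcoeff_map_mpoly !fps_truncE.
by case: ifP => // _; rewrite raddf0.
Qed.

Fact fps_map_additive n : additive (@fps_map n).
Proof. by move=> a b; apply/fpsP => m; apply: rmorphB. Qed.
Fact fps_map_multiplicative n : multiplicative (@fps_map n).
Proof.
split=> [a b|]; apply/fpsP => m; last first.
  by rewrite /fps_map !fps1E rmorph_nat.
rewrite (fpsME _ _ (leqnn _)) !trunc_map -rmorphM mcoeff_map_mpoly.
by rewrite -fpsME.
Qed.
HB.instance Definition _ n := GRing.isAdditive.Build _ _ _ (@fps_map_additive n).
HB.instance Definition _ n := GRing.isMultiplicative.Build _ _ _ (@fps_map_multiplicative n).

Lemma fps_mapC n c : fps_map (fpsC c : fps n K) = fpsC (theta c).
Proof. by apply/fpsP => m; rewrite /fps_map !fpsCE; case: ifP => // _; rewrite rmorph0. Qed.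
Lemma fps_map_mon n m : fps_map (mon m : fps n K) = mon m.
Proof. by apply/fpsP => m'; rewrite /fps_map !monE rmorph_nat. Qed.

Lemma fps_map_fsubst n p (a : fps n K) (b : 'I_n -> fps p K) :
  (forall i, b i 0%MM = 0) ->
  fps_map (fsubst a b) = fsubst (fps_map a) (fun i => fps_map (b i)).
Proof.
move=> b0; apply/fpsP => m.
have b0' i : fps_map (b i) 0%MM = 0 by rewrite /fps_map b0 rmorph0.
rewrite (fsubstE _ b0' (leqnn _)) trunc_map /fps_map (fsubstE _ b0 (leqnn _)).
rewrite -[LHS]/(fps_map _ m); congr (_ m); set q := fps_trunc a _.
rewrite [in RHS](mpolyE q) raddf_sum [map_mpoly _ _]raddf_sum /=.
rewrite [ev _ (\sum_(_ <- _) _)]raddf_sum /=; apply: eq_bigr => k _.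
rewrite map_mpolyZ map_mpolyX -mul_mpolyC [in RHS]rmorphM /= evC evX.
rewrite [in LHS]rmorphM /= fps_mapC [fps_map (mmap1 _ _)]rmorph_prod /=.
rewrite [in RHS]/mmap1; under [in RHS]eq_bigr => i _ do rewrite -[fun=> _]/(fps_map (b i)) -rmorphXn /=.
by [].
Qed.

Lemma fps_map_vanish n (w : 'I_n -> nat) N a : vanish w N a -> vanish w N (fps_map a).
Proof. by move=> h m hm; rewrite /fps_map h // rmorph0. Qed.
End MapCoef.

(** * Derivations and the chain rule *)

Section Deriv.
Variables (n : nat) (K : comNzRingType).
Implicit Types (a b : fps n K).
Notation D := (fps_deriv).

Lemma derivB i a b : D i (a - b) = D i a - D i b.
Proof. by apply/fpsP => m; rewrite fpsBE /fps_deriv fpsBE mulrnBl. Qed.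
HB.instance Definition _ i := GRing.isAdditive.Build (fps n K) (fps n K)
  (@fps_deriv n K i) (derivB i).

Lemma deriv_mpoly i (q : {mpoly K[n]}) :
  D i (fps_of_mpoly q) = fps_of_mpoly q^`M(i).
Proof. by apply/fpsP => m; rewrite /fps_of_mpoly mcoeff_deriv. Qed.

Lemma derivC i c : D i (fpsC c : fps n K) = 0.
Proof. by rewrite fpsC_mpoly deriv_mpoly mderivC rmorph0. Qed.

Lemma deriv_var i j : D i (var j : fps n K) = (i == j)%:R.
Proof.
rewrite varE mon_mpoly deriv_mpoly mderivX mnm1E eq_sym.
case: eqP => [->|_]; last by rewrite scale0r rmorph0.
rewrite scale1r; have -> : (U_(j) - U_(j))%MM = 0%MM :> 'X_{1..n}.
  by apply/mnmP => k; rewrite mnmBE subnn mnm0E.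
by rewrite mpolyX0 rmorph1.
Qed.

Lemma derivM i a b : D i (a * b) = D i a * b + a * D i b.
Proof.
apply/fpsP => m; set N := (mdeg m).+1.
have hN : (mdeg m <= N)%N by exact: leqnSn.
have hU : (mdeg (m + U_(i)) <= N)%N by rewrite mdegD mdeg1 addn1.
rewrite {1}/fps_deriv (fpsME _ _ hU) -mcoeff_deriv mderivM mcoeffD fpsDE !(fpsME _ _ hN).
congr (_ + _); apply: mcoeffM_congr => m' h //;
by rewrite mcoeff_deriv !fps_truncE mdegD mdeg1 addn1 ltnS h (leq_trans h).
Qed.

Lemma deriv_vanish i w N a : vanish w N a -> vanish w (N - w i) (D i a).
Proof.
move=> h m hm; rewrite /fps_deriv h ?mul0rn // mwtD mwtU; lia.
Qed.

(** The derivation defined by the vector field with components t. *)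
Definition along (t : 'I_n -> fps n K) a := \sum_i t i * D i a.
Fact along_additive t : additive (along t).
Proof.
by move=> a b; rewrite /along -sumrB; apply: eq_bigr => i _; rewrite derivB mulrBr.
Qed.
HB.instance Definition _ t := GRing.isAdditive.Build _ _ _ (along_additive t).

Lemma alongM t a b : along t (a * b) = along t a * b + a * along t b.
Proof.
rewrite /along mulr_suml mulr_sumr -big_split; apply: eq_bigr => i _ /=.
by rewrite derivM; ring.
Qed.
Lemma alongC t c : along t (fpsC c) = 0.
Proof. by rewrite /along big1 // => i _; rewrite derivC mulr0. Qed.
Lemma along1 t : along t 1 = 0.
Proof. by rewrite -[1](rmorph1 (@fpsC n K)) alongC. Qed.
Lemma along_var t i : along t (var i) = t i.
Proof.
rewrite /along (bigD1 i) //= deriv_var eqxx mulr1 big1 ?addr0 // => j h.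
by rewrite deriv_var (negbTE h) mulr0.
Qed.
Lemma alongX t a k : along t (a ^+ k) = k%:R * a ^+ k.-1 * along t a.
Proof.
elim: k => [|k IH]; first by rewrite expr0 along1 !mul0r.
rewrite exprS alongM IH /=; case: k IH => [|k] IH; first by rewrite !expr0; ring.
by rewrite /= exprS -[k.+2%:R]natr1; ring.
Qed.
(** A field whose components have weighted order at least s above the weights of their
    variables raises weighted orders by s. *)
Lemma along_vanish t w s N a :
  (forall i, vanish w (w i + s) (t i)) -> vanish w N a -> vanish w (N + s) (along t a).
Proof.
move=> ht ha; apply: vanish_sum => i _.
apply: (@vanishW _ _ _ ((w i + s) + (N - w i))); first by lia.
exact/vanishM/deriv_vanish.
Qed.
End Deriv.

Section Chain.
Variables (n p : nat) (K : comNzRingType) (t : 'I_p -> fps p K).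
Variable (b : 'I_n -> fps p K).

(** The set of polynomials satisfying the chain rule contains the constants and the variables,
    and is closed under sums and products. *)
Lemma along_ev (q : {mpoly K[n]}) :
  along t (ev b q) = \sum_i ev b q^`M(i) * along t (b i).
Proof.
pose P (q : {mpoly K[n]}) := along t (ev b q) = \sum_i ev b q^`M(i) * along t (b i).
have PD q1 q2 : P q1 -> P q2 -> P (q1 + q2).
  rewrite /P rmorphD raddfD /= => -> ->; rewrite -big_split; apply: eq_bigr => i _.
  by rewrite mderivD rmorphD mulrDl.
have PM q1 q2 : P q1 -> P q2 -> P (q1 * q2).
  rewrite /P rmorphM alongM /= => -> ->; rewrite mulr_suml mulr_sumr -big_split.
  by apply: eq_bigr => i _; rewrite mderivM rmorphD !rmorphM /=; ring.
have PC c : P c%:MP.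
  by rewrite /P evC alongC big1 // => i _; rewrite mderivC rmorph0 mul0r.
have PX i : P 'X_i.
  rewrite /P evX mmap1U (bigD1 i) //= big1 ?addr0 => [|j h].
    rewrite mderivX mnm1E eqxx scale1r.
    have -> : (U_(i) - U_(i))%MM = 0%MM :> 'X_{1..n}.
      by apply/mnmP => k; rewrite mnmBE subnn mnm0E.
    by rewrite mpolyX0 rmorph1 mul1r.
  by rewrite mderivX mnm1E eq_sym (negbTE h) scale0r rmorph0 mul0r.
rewrite -/(P q) (mpolyE q).
elim/big_ind: _ => [|q1 q2|m _]; [by rewrite -[0]mpolyC0; apply: PC|exact: PD|].
rewrite -mul_mpolyC; apply: (PM _ _ (PC _)); rewrite mpolyXE_id.
elim/big_ind: _ => [|q1 q2|i _]; [by rewrite -[1]mpolyC1; apply: PC|exact: PM|].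
elim: (m i) => [|k IH]; first by rewrite expr0 -[1]mpolyC1; apply: PC.
by rewrite exprS; exact: (PM _ _ (PX i) IH).
Qed.

Lemma deriv_along i (a : fps p K) : fps_deriv i a = along (fun j => (i == j)%:R) a.
Proof.
rewrite /along (bigD1 i) //= eqxx mul1r big1 ?addr0 // => j h.
by rewrite eq_sym (negbTE h) mul0r.
Qed.

(** A derivation lowers degrees by at most one, so truncating one degree beyond the
    coefficient reduces the chain rule to polynomials. *)
Lemma along_fsubst (a : fps n K) : (forall i, b i 0%MM = 0) ->
  along t (fsubst a b) = \sum_i fsubst (fps_deriv i a) b * along t (b i).
Proof.
move=> b0; apply/fpsP => m; set N := (mdeg m).+1.
have h1 := fsubst_trunc (N := N) a b0.
have h2 : vanish (@wdeg p) N (along t (fsubst a b - ev b (fps_trunc a N))).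
  apply: vanish_sum => i _; apply: vanishMl.
  by have := deriv_vanish (i := i) h1; rewrite subn1.
have h3 i : vanish (@wdeg p) N (fsubst (fps_deriv i a) b - ev b (fps_trunc a N)^`M(i)).
  rewrite -fsubst_of_mpoly // -fsubstB //.
  apply: (fsubst_vanish (w := @wdeg n) b0); first by move=> j; apply/vanish_deg1.
  move=> m'; rewrite mwt_deg => hm'.
  rewrite fpsBE /fps_of_mpoly mcoeff_deriv /fps_deriv fps_truncE mdegD mdeg1 addn1.
  by rewrite hm' subrr.
have hm : (mwt (@wdeg p) m < N)%N by rewrite mwt_deg.
transitivity (along t (ev b (fps_trunc a N)) m).
  by apply/eqP; rewrite -subr_eq0 -fpsBE -raddfB; apply/eqP/h2.
apply/eqP; rewrite along_ev eq_sym -subr_eq0 -fpsBE -sumrB; apply/eqP.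
by apply: vanish_sum hm => i _; rewrite -mulrBl; apply: vanishMr.
Qed.
End Chain.

Lemma deriv_fsubst n p (K : comNzRingType) (a : fps n K) (b : 'I_n -> fps p K) j :
  (forall i, b i 0%MM = 0) ->
  fps_deriv j (fsubst a b) = \sum_i fsubst (fps_deriv i a) b * fps_deriv j (b i).
Proof.
move=> b0; rewrite deriv_along along_fsubst //.
by apply: eq_bigr => i _; rewrite -deriv_along.
Qed.

(** * Contractions *)

(** Banach fixed points for the weighted-order metric: the iterates from 0 agree in ever
    higher weights, and each coefficient is read off once it is stable. *)
Lemma fps_fixpoint n (K : comNzRingType) (w : 'I_n -> nat) (F : fps n K -> fps n K) :
  (forall N a b, vanish w N (a - b) -> vanish w N.+1 (F a - F b)) ->
  exists a, F a = a.
Proof.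
move=> hF; pose x j := iter j F 0.
have stab j d : vanish w j (x j - x (d + j)%N).
  by elim: j => // j IH; rewrite addnS /x !iterS; apply: hF.
pose a : fps n K := fun m => x (mwt w m).+1 m.
have ha j : vanish w j (a - x j).
  move=> m h; apply/eqP; rewrite fpsBE subr_eq0 /a -(subnK h) -subr_eq0 -fpsBE.
  by apply/eqP/stab.
exists a; apply/fpsP => m; apply/eqP; rewrite -subr_eq0 -fpsBE.
have -> : F a - a = (F a - F (x (mwt w m))) - (a - x (mwt w m).+1).
  by rewrite [x _.+1]iterS -/(x _); ring.
by apply/eqP; apply: (vanishB (hF _ _ _ (ha _)) (ha _)).
Qed.

(** The inverse of c + (a - c), where c is the constant term, is the fixed point of
    b = (1 - (a - c) b) / c. *)
Lemma fps_inv n (K : fieldType) (a : fps n K) : a 0%MM != 0 -> exists b, a * b = 1.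
Proof.
move=> ha; set c := a 0%MM.
have ec : fpsC c * fpsC c^-1 = 1 :> fps n K by rewrite -rmorphM divff ?rmorph1.
have [|b hb] := @fps_fixpoint n K (@wdeg n)
  (fun b => fpsC c^-1 * (1 - (a - fpsC c) * b)).
  move=> N b b' h; rewrite -mulrBr; apply: vanishMl.
  have -> : 1 - (a - fpsC c) * b - (1 - (a - fpsC c) * b') = - ((a - fpsC c) * (b - b')).
    by ring.
  apply: vanishN; rewrite -add1n; apply: vanishM h.
  by apply/vanish_deg1; rewrite fpsBE fpsCE eqxx subrr.
exists b; rewrite -[a](subrK (fpsC c)) mulrDl -{2}hb mulrA ec mul1r.
by rewrite addrC subrK.
Qed.

(** * Coefficients of monomial and binomial substitutions *)

Section Monomials.
Variable (K : comNzRingType).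

Lemma fps_sumE n I (r : seq I) (P : pred I) (F : I -> fps n K) m :
  (\sum_(i <- r | P i) F i) m = \sum_(i <- r | P i) F i m.
Proof. by elim/big_rec2: _ => // i x y _ <-. Qed.

Lemma fsubst_monomial n p (a : fps n K) (c : 'I_n -> K) (e : 'I_n -> 'X_{1..p}) m :
  (forall i, e i != 0%MM) ->
  let b i := fpsC (c i) * mon (e i) in
  forall N, (mdeg m <= N)%N ->
  fsubst a b m = \sum_(m' : 'X_{1..n < N.+1})
    a m' * (\prod_i c i ^+ m' i) * (m == \sum_i e i *+ m' i)%MM%:R.
Proof.
move=> he b N hN.
have b0 i : b i 0%MM = 0.
  by rewrite /b fpsCM monE eq_sym (negbTE (he i)) mulr0.
rewrite (fsubstE _ b0 hN) /ev (mmapE N.+1); last first.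
  apply/leq_trans/(leqnn N.+1); rewrite msizeE; apply/bigmax_leqP_seq => m' hm' _.
  by rewrite ltnS; move: hm'; rewrite mcoeff_msupp fps_truncE; case: ifP; rewrite ?eqxx.
rewrite fps_sumE; apply: eq_bigr => m' _.
have -> : mmap1 b m' = fpsC (\prod_i c i ^+ m' i) * mon (\sum_i e i *+ m' i)%MM.
  transitivity (\prod_i (fpsC (c i ^+ m' i) * mon (e i *+ m' i)%MM : fps p K)).
    by apply: eq_bigr => i _; rewrite exprMn -monX rmorphXn.
  rewrite big_split rmorph_prod /=; congr (_ * _).
  rewrite mon_mpoly; elim: (index_enum _) => [|i r IH]; first by rewrite !big_nil mpolyX0 rmorph1.
  by rewrite !big_cons IH mpolyXD rmorphM mon_mpoly.
rewrite mulrA -rmorphM fpsCM monE fps_truncE.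
by have := bmdeg m'; rewrite ltnS => ->.
Qed.

(** If the exponents of the substituted monomials are independent, every coefficient of the
    result comes from a single coefficient of a. *)
Lemma fsubst_monomial_in n p (a : fps n K) (c : 'I_n -> K) (e : 'I_n -> 'X_{1..p}) (m' : 'X_{1..n}) :
  (forall i, e i != 0%MM) ->
  injective (fun m' : 'X_{1..n} => \sum_i e i *+ m' i)%MM ->
  fsubst a (fun i => fpsC (c i) * mon (e i)) (\sum_i e i *+ m' i)%MM
  = a m' * \prod_i c i ^+ m' i.
Proof.
move=> he hinj; set m := (\sum_i _)%MM.
have hN : (mdeg m <= mdeg m + mdeg m')%N by exact: leq_addr.
rewrite (fsubst_monomial _ _ he hN).
have hm' : (mdeg m' < (mdeg m + mdeg m').+1)%N by rewrite ltnS leq_addl.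
rewrite (bigD1 (BMultinom hm')) //= eqxx mulr1 [X in _ + X]big1 ?addr0 // => i.
rewrite bmeqP /= => hi; case: eqP; rewrite ?mulr0 // => h.
by case/eqP: hi; apply: hinj; rewrite -h.
Qed.

Lemma fsubst_monomial_out n p (a : fps n K) (c : 'I_n -> K) (e : 'I_n -> 'X_{1..p}) (m : 'X_{1..p}) :
  (forall i, e i != 0%MM) -> (forall m' : 'X_{1..n}, m != \sum_i e i *+ m' i)%MM ->
  fsubst a (fun i => fpsC (c i) * mon (e i)) m = 0.
Proof.
move=> he hm; rewrite (fsubst_monomial _ _ he (leqnn _)) big1 // => i _.
by rewrite (negbTE (hm _)) mulr0.
Qed.

Lemma binomial_coef n (m1 m2 m : 'X_{1..n}) (p q : K) N :
  ((fpsC p * mon m1 + fpsC q * mon m2) ^+ N) m =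
  \sum_(i < N.+1) ('C(N, i)%:R * p ^+ (N - i) * q ^+ i)
     * (m == m1 *+ (N - i) + m2 *+ i)%MM%:R.
Proof.
rewrite exprDn fps_sumE; apply: eq_bigr => i _.
have -> : (fpsC p * mon m1) ^+ (N - i) * (fpsC q * mon m2) ^+ i *+ 'C(N, i) =
  fpsC ('C(N, i)%:R * p ^+ (N - i) * q ^+ i) * mon (m1 *+ (N - i) + m2 *+ i)%MM.
  by rewrite monD !monX !rmorphM !rmorphXn rmorph_nat /= !exprMn -mulr_natl; ring.
by rewrite fpsCM monE.
Qed.

Lemma binomial_coef1 n (m1 m2 m : 'X_{1..n}) (p q : K) N j : (j <= N)%N ->
  m = (m1 *+ (N - j) + m2 *+ j)%MM ->
  (forall i, (i <= N)%N -> (m1 *+ (N - i) + m2 *+ i)%MM = m -> i = j) ->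
  ((fpsC p * mon m1 + fpsC q * mon m2) ^+ N) m = 'C(N, j)%:R * p ^+ (N - j) * q ^+ j.
Proof.
move=> hj em hinj; rewrite binomial_coef.
have hj' : (j < N.+1)%N by [].
rewrite (bigD1 (Ordinal hj')) //= -em eqxx mulr1 big1 ?addr0 // => i hi.
case: eqP; rewrite ?mulr0 // => e; case/eqP: hi; apply/val_inj => /=.
by apply: hinj => //; exact: (ltn_ord i).
Qed.
End Monomials.

(** * Series in two variables *)

Section Two.
Definition mn2 j l : 'X_{1..2} := (U_(jx) *+ j + U_(ju) *+ l)%MM.
Lemma mn2_x j l : mn2 j l jx = j.
Proof. by rewrite /mn2 mnmDE !mulmnE !mnm1E /= mul1n mul0n addn0. Qed.
Lemma mn2_u j l : mn2 j l ju = l.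
Proof. by rewrite /mn2 mnmDE !mulmnE !mnm1E /= mul1n mul0n. Qed.
Lemma ord2P (P : 'I_2 -> Prop) : P jx -> P ju -> forall i, P i.
Proof.
move=> h0 h1 [[|[|i]] hi] //.
  by have -> : Ordinal hi = jx by exact: val_inj.
by have -> : Ordinal hi = ju by exact: val_inj.
Qed.
Lemma mnm2E (m : 'X_{1..2}) : m = mn2 (m jx) (m ju).
Proof. by apply/mnmP; apply: ord2P; rewrite ?mn2_x ?mn2_u. Qed.
Lemma mn2_eq j l j' l' : (mn2 j l == mn2 j' l') = (j == j') && (l == l').
Proof.
apply/eqP/andP => [e|[/eqP-> /eqP->]] //.
by split; apply/eqP; [rewrite -(mn2_x j l) e mn2_x|rewrite -(mn2_u j l) e mn2_u].
Qed.
Lemma sum2 (V : nmodType) (F : 'I_2 -> V) : \sum_i F i = F jx + F ju.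
Proof. by rewrite !big_ord_recl big_ord0 addr0; congr (F _ + F _); exact: val_inj. Qed.
Lemma prod2 (V : comPzRingType) (F : 'I_2 -> V) : \prod_i F i = F jx * F ju.
Proof. by rewrite !big_ord_recl big_ord0 mulr1; congr (F _ * F _); exact: val_inj. Qed.
Lemma sumn2 (F : 'I_2 -> nat) : (\sum_i F i = F jx + F ju)%N.
Proof. exact: sum2. Qed.
Lemma summ2 n (F : 'I_2 -> 'X_{1..n}) : (\sum_i F i = F jx + F ju)%MM.
Proof. by rewrite !big_ord_recl big_ord0 addm0; congr (F _ + F _)%MM; exact: val_inj. Qed.
Lemma mwt2 a b j l : mwt (pair2 a b) (mn2 j l) = (a * j + b * l)%N.
Proof. by rewrite /mwt sumn2 mn2_x mn2_u. Qed.
Lemma mdeg2 j l : mdeg (mn2 j l) = (j + l)%N.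
Proof. by rewrite mdegE sumn2 mn2_x mn2_u. Qed.

Lemma vanish2P (K : comNzRingType) a b N (s : fps 2 K) :
  vanish (pair2 a b) N s <-> forall j l, (a * j + b * l < N)%N -> s (mn2 j l) = 0.
Proof.
split=> [h j l hjl|h m]; first by apply: h; rewrite mwt2.
by rewrite (mnm2E m) mwt2; apply: h.
Qed.
Lemma pair2x T (a b : T) : pair2 a b jx = a. Proof. by []. Qed.
Lemma pair2u T (a b : T) : pair2 a b ju = b. Proof. by []. Qed.
Lemma mn2_0 : mn2 0 0 = 0%MM.
Proof. by rewrite /mn2 !mulm0n addm0. Qed.
Lemma mn2_10 : mn2 1 0 = U_(jx)%MM.
Proof. by rewrite /mn2 mulm1n mulm0n addm0. Qed.
Lemma mn2_01 : mn2 0 1 = U_(ju)%MM.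
Proof. by rewrite /mn2 mulm1n mulm0n add0m. Qed.
Lemma mon2 (K : comNzRingType) j l : mon (mn2 j l) = var jx ^+ j * var ju ^+ l :> fps 2 K.
Proof. by rewrite monD !monX. Qed.
End Two.

(** * Real and imaginary parts *)

Section Complex.
Variable (R : rcfType) (n : nat).
Notation C := R[i].
Implicit Types (a b : fps n C) (r s : fps n R).

Definition rc : fps n R -> fps n C := @fps_map R C (real_complex R) n.
HB.instance Definition _ := GRing.RMorphism.on rc.
Definition cj : fps n C -> fps n C := @fps_map C C (@conjc R) n.
HB.instance Definition _ := GRing.RMorphism.on cj.
Definition re a : fps n R := fun m => complex.Re (a m).
Definition im a : fps n R := fun m => complex.Im (a m).

Fact re_additive : additive re.
Proof. by move=> a b; apply/fpsP => m; rewrite fpsBE /re fpsBE raddfB. Qed.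
Fact im_additive : additive im.
Proof. by move=> a b; apply/fpsP => m; rewrite fpsBE /im fpsBE raddfB. Qed.
HB.instance Definition _ := GRing.isAdditive.Build _ _ _ re_additive.
HB.instance Definition _ := GRing.isAdditive.Build _ _ _ im_additive.

Notation I := (fpsC ('i%C : C)).

Lemma II : I * I = -1 :> fps n C.
Proof. by rewrite -rmorphM -expr2 sqr_i rmorphN rmorph1. Qed.
Lemma reE r s : re (rc r + I * rc s) = r.
Proof.
apply/fpsP => m; rewrite /re fpsDE fpsCM /rc /fps_map /=.
by rewrite ?(mul0r, mulr0, mul1r, subr0, sub0r, addr0, add0r, oppr0).
Qed.
Lemma imE r s : im (rc r + I * rc s) = s.
Proof.
apply/fpsP => m; rewrite /im fpsDE fpsCM /rc /fps_map /=.
by rewrite ?(mul0r, mulr0, mul1r, subr0, sub0r, addr0, add0r, oppr0).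
Qed.
Lemma rcE a : a = rc (re a) + I * rc (im a).
Proof.
apply/fpsP => m; rewrite fpsDE fpsCM /rc /fps_map /re /im; case: (a m) => x y /=.
by rewrite -[RHS]/(Complex _ _) ?(mul0r, mulr0, mul1r, subr0, sub0r, addr0, add0r, oppr0).
Qed.
Lemma rc_re r : re (rc r) = r.
Proof. by have := reE r 0; rewrite rmorph0 mulr0 addr0. Qed.
Lemma rc_im r : im (rc r) = 0.
Proof. by have := imE r 0; rewrite rmorph0 mulr0 addr0. Qed.
Lemma reM a b : re (a * b) = re a * re b - im a * im b.
Proof.
rewrite {1}(rcE a) {1}(rcE b) -(reE (re a * re b - im a * im b) (re a * im b + im a * re b)).
congr re; rewrite rmorphB rmorphD !rmorphM /=.
transitivity (rc (re a) * rc (re b) + (I * I) * (rc (im a) * rc (im b))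
   + I * (rc (re a) * rc (im b) + rc (im a) * rc (re b))); first by ring.
by rewrite II; ring.
Qed.
Lemma imM a b : im (a * b) = re a * im b + im a * re b.
Proof.
rewrite {1}(rcE a) {1}(rcE b) -(imE (re a * re b - im a * im b) (re a * im b + im a * re b)).
congr im; rewrite rmorphB rmorphD !rmorphM /=.
transitivity (rc (re a) * rc (re b) + (I * I) * (rc (im a) * rc (im b))
   + I * (rc (re a) * rc (im b) + rc (im a) * rc (re b))); first by ring.
by rewrite II; ring.
Qed.
Lemma re_rcM r a : re (rc r * a) = r * re a.
Proof. by rewrite reM rc_re rc_im mul0r subr0. Qed.
Lemma im_rcM r a : im (rc r * a) = r * im a.
Proof. by rewrite imM rc_re rc_im mul0r addr0. Qed.
Lemma rcC (c : R) : rc (fpsC c) = fpsC (c%:C)%C.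
Proof. exact: fps_mapC. Qed.
Lemma rc_mon m : rc (mon m) = mon m.
Proof. exact: fps_map_mon. Qed.
Lemma re_C (c : C) : re (fpsC c) = fpsC (complex.Re c).
Proof. by apply/fpsP => m; rewrite /re !fpsCE; case: ifP. Qed.
Lemma im_C (c : C) : im (fpsC c) = fpsC (complex.Im c).
Proof. by apply/fpsP => m; rewrite /im !fpsCE; case: ifP. Qed.
Lemma re_I a : re (I * a) = - im a.
Proof. by rewrite reM re_C im_C /= rmorph0 rmorph1 mul0r mul1r sub0r. Qed.
Lemma im_I a : im (I * a) = re a.
Proof. by rewrite imM re_C im_C /= rmorph0 rmorph1 mul0r mul1r add0r. Qed.
Lemma cjE a : cj a = rc (re a) - I * rc (im a).
Proof.
apply/fpsP => m; rewrite /cj /fps_map /rc fpsBE fpsCM /fps_map /re /im.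
by case: (a m) => x y /=; rewrite -[RHS]/(Complex _ _) ?(mul0r, mulr0, mul1r, subr0, sub0r, addr0, add0r, oppr0).
Qed.
Lemma re_cj a : a + cj a = 2%:R * rc (re a).
Proof. by rewrite cjE {1}(rcE a); ring. Qed.
Lemma im_cj a : a - cj a = 2%:R * I * rc (im a).
Proof. by rewrite cjE {1}(rcE a); ring. Qed.

Lemma re_vanish w N a : vanish w N a -> vanish w N (re a).
Proof. by move=> h m hm; rewrite /re h. Qed.
Lemma im_vanish w N a : vanish w N a -> vanish w N (im a).
Proof. by move=> h m hm; rewrite /im h. Qed.
Lemma rc_vanish w N r : vanish w N r -> vanish w N (rc r).
Proof. exact: fps_map_vanish. Qed.

Lemma re_deriv i a : re (fps_deriv i a) = fps_deriv i (re a).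
Proof. by apply/fpsP => m; rewrite /re /fps_deriv raddfMn. Qed.
Lemma im_deriv i a : im (fps_deriv i a) = fps_deriv i (im a).
Proof. by apply/fpsP => m; rewrite /im /fps_deriv raddfMn. Qed.
Lemma re_along (t : 'I_n -> fps n R) a : re (along (fun i => rc (t i)) a) = along t (re a).
Proof. by rewrite raddf_sum; apply: eq_bigr => i _; rewrite /= re_rcM re_deriv. Qed.
Lemma im_along (t : 'I_n -> fps n R) a : im (along (fun i => rc (t i)) a) = along t (im a).
Proof. by rewrite raddf_sum; apply: eq_bigr => i _; rewrite /= im_rcM im_deriv. Qed.
End Complex.

Section ComplexComp.
Variable (R : rcfType) (n p : nat) (b : 'I_n -> fps p R).
Hypothesis b0 : forall i, b i 0%MM = 0.

Let rb0 i : rc (b i) 0%MM = 0.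
Proof. by rewrite /rc /fps_map b0. Qed.

Lemma rc_fsubst a : rc (fsubst a b) = fsubst (rc a) (fun i => rc (b i)).
Proof. exact: fps_map_fsubst. Qed.

Lemma fsubst_rcE (a : fps n R[i]) : fsubst a (fun i => rc (b i)) =
  rc (fsubst (re a) b) + fpsC 'i%C * rc (fsubst (im a) b).
Proof.
pose phi := subst (b := fun i => rc (b i)) rb0.
have ea : phi a = phi (rc (re a)) + phi (fpsC 'i%C) * phi (rc (im a)).
  by rewrite -rmorphM -rmorphD -rcE.
have eI : phi (fpsC 'i%C) = fpsC 'i%C := fsubstC (b := fun i => rc (b i)) rb0 _.
rewrite eI in ea.
rewrite !rc_fsubst.
exact: ea.
Qed.
Lemma re_fsubst (a : fps n R[i]) : re (fsubst a (fun i => rc (b i))) = fsubst (re a) b.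
Proof. by rewrite fsubst_rcE reE. Qed.
Lemma im_fsubst (a : fps n R[i]) : im (fsubst a (fun i => rc (b i))) = fsubst (im a) b.
Proof. by rewrite fsubst_rcE imE. Qed.
End ComplexComp.

(** * Transformations tangent to the identity *)

Section Unipotent.
Variables (n : nat) (K : comNzRingType) (w : 'I_n -> nat).
Hypothesis w_gt0 : forall i, (0 < w i)%N.
Implicit Types Phi L : 'I_n -> fps n K.

Definition unipotent Phi := forall i, vanish w (w i).+1 (Phi i - var i).

Lemma unipotent_vanish Phi : unipotent Phi -> forall i, vanish w (w i) (Phi i).
Proof.
move=> h i; rewrite -[Phi i](subrK (var i)); apply: vanishD; last exact: vanish_var.
exact: vanishW (h i).
Qed.
Lemma unipotent0 Phi : unipotent Phi -> forall i, Phi i 0%MM = 0.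
Proof. by move=> h i; apply: (vanish_pos (w := w) (N := w i)) => //; apply: unipotent_vanish. Qed.

(** Substitution of Phi differs from the identity by an operator that raises the weight, so
    L o Phi = var is a fixed point equation for L. *)
Lemma unipotent_left_inverse Phi : unipotent Phi ->
  exists2 L, unipotent L & forall i, fsubst (L i) Phi = var i.
Proof.
move=> h; have h0 := unipotent0 h; have hv := unipotent_vanish h.
have raise N a : vanish w N a -> vanish w N.+1 (fsubst a Phi - a).
  move=> ha; rewrite -{2}(fsubst_id a) -addn1.
  apply: (fsubst_congr (w := w)) => //; [exact: var0|exact: vanish_var|].
  by move=> i; rewrite addn1.
have ex i : exists L : fps n K, fsubst L Phi = var i /\ vanish w (w i).+1 (L - var i).
  have [|L hL] := @fps_fixpoint n K w (fun l : fps n K => var i - (fsubst l Phi - l)).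
    move=> N a b hab.
    have -> : var i - (fsubst a Phi - a) - (var i - (fsubst b Phi - b)) =
      - ((fsubst a Phi - fsubst b Phi) - (a - b)) by ring.
    by rewrite -fsubstB //; apply/vanishN/raise.
  have hi N : (N <= w i)%N -> vanish w N L.
    elim: N => // N IH hN; rewrite -hL; apply: vanishB; first exact/(vanishW hN)/vanish_var.
    by apply: raise; apply: IH; apply: ltnW.
  exists L; split; first by rewrite -[LHS](addrNK L) -[X in _ + X]hL; ring.
  rewrite -{1}hL addrAC subrr sub0r; apply/vanishN/raise/hi/leqnn.
have [L hL] := choice ex.
by exists L => i; have [] := hL i.
Qed.

(** A left inverse L is tangent to the identity and has a left inverse L' itself, which must be
    Phi: L' = L' o (L o Phi) = (L' o L) o Phi = Phi. *)
Lemma unipotent_inverse Phi : unipotent Phi ->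
  exists L, [/\ forall i, L i 0%MM = 0, forall i, fsubst (Phi i) L = var i
    & forall i, fsubst (L i) Phi = var i].
Proof.
move=> h; have [L hL e1] := unipotent_left_inverse h.
have [L' hL' e2] := unipotent_left_inverse hL.
exists L; split=> //; first exact: unipotent0.
move=> i; have -> : Phi i = L' i; last exact: e2.
rewrite -(fsubst_id (L' i)); have -> : (var : 'I_n -> fps n K) = (fun i => fsubst (L i) Phi).
  by apply: funext => j; rewrite e1.
rewrite -fsubstA; [|exact: unipotent0|exact: unipotent0].
by rewrite e2 fsubst_var //; apply: unipotent0.
Qed.
End Unipotent.

(** * Points of the hypersurface *)

Section Hypersurface.
Variables (R : realType) (k : nat).
Hypothesis hk : (2 < k)%N.
Notation C := R[i].

Definition wt2 : 'I_2 -> nat := pair2 1%N k.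
Definition wt3 (i : 'I_3) : nat := if i == pu then k else 1%N.

Lemma w2_gt0 i : (0 < wt2 i)%N.
Proof. by elim/ord2P: i => //; rewrite /wt2 pair2u; lia. Qed.

Notation x := (var px : fps 3 R).
Notation y := (var py : fps 3 R).
Notation u := (var pu : fps 3 R).
Notation I := (fpsC ('i%C : C)).

Definition xu_pt : 'I_2 -> fps 3 R := pair2 x u.
Definition zpt : fps 3 C := rc x + I * rc y.
Definition wpt (Q : fps 2 R) : fps 3 C := rc u + I * rc (fsubst Q xu_pt).
Definition pt Q : 'I_2 -> fps 3 C := pair2 zpt (wpt Q).

Lemma cplxE n (r s : fps n R) : (fun m => (r m +i* s m)%C) = rc r + I * rc s.
Proof.
apply/fpsP => m; rewrite fpsDE fpsCM /rc /fps_map /=.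
by rewrite -[RHS]/(Complex _ _) ?(mul0r, mulr0, mul1r, subr0, sub0r, addr0, add0r, oppr0).
Qed.

Lemma generic_pointE Q : generic_point Q = pt Q.
Proof.
apply: funext; apply: ord2P.
  by rewrite /generic_point /pt !(pair2x, pair2u) cplxE !fps_varE.
rewrite /generic_point /pt !(pair2x, pair2u) cplxE !fps_varE.
by rewrite /wpt fsubst.unlock.
Qed.

Lemma rhsE (G : fps 2 R) : rhs k G = var jx ^+ k + G.
Proof. by rewrite varE -monX; apply/fpsP => m; rewrite fpsDE monE. Qed.

Lemma fsubst_rhs p (G : fps 2 R) (b : 'I_2 -> fps p R) : (forall i, b i 0%MM = 0) ->
  fsubst (rhs k G) b = b jx ^+ k + fsubst G b.
Proof.
move=> b0; rewrite rhsE -[LHS]/(subst b0 _) rmorphD rmorphXn; congr (_ ^+ _ + _).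
exact: fsubst_var.
Qed.

Lemma vanish_x : vanish wt3 1 x. Proof. exact: (@vanish_var _ _ wt3 px). Qed.
Lemma vanish_y : vanish wt3 1 y. Proof. exact: (@vanish_var _ _ wt3 py). Qed.
Lemma vanish_u : vanish wt3 k u. Proof. exact: (@vanish_var _ _ wt3 pu). Qed.

Lemma vanish_rci N (r s : fps 3 R) :
  vanish wt3 N r -> vanish wt3 N s -> vanish wt3 N (rc r + I * rc s).
Proof. by move=> h1 h2; apply: vanishD; [|apply: vanishMl]; apply: rc_vanish. Qed.

Lemma vanish_zpt : vanish wt3 1 zpt.
Proof. exact: (vanish_rci vanish_x vanish_y). Qed.

Lemma vanish_xu i : vanish wt3 (wt2 i) (xu_pt i).
Proof. elim/ord2P: i; [exact: vanish_x|exact: vanish_u]. Qed.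
Lemma xu0 i : xu_pt i 0%MM = 0.
Proof. exact: (vanish_pos (w2_gt0 i) (@vanish_xu i)). Qed.

Variable G : fps 2 R.
Hypothesis hG : weight_gt k G.

Lemma weight_vanish : vanish wt2 k.+1 G.
Proof.
apply/vanish2P => j l; rewrite ltnS => h; apply/eqP; apply: contraTT h.
by move/hG; rewrite mn2_x mn2_u; lia.
Qed.

Lemma vanish_Gxu : vanish wt3 k.+1 (fsubst G xu_pt).
Proof. exact: (fsubst_vanish xu0 vanish_xu weight_vanish). Qed.

Lemma rhs_xu : fsubst (rhs k G) xu_pt = x ^+ k + fsubst G xu_pt.
Proof. by rewrite fsubst_rhs //; apply: xu0. Qed.

Lemma vanish_xk : vanish wt3 k (x ^+ k).
Proof. by have := @vanishX _ _ wt3 1 x k vanish_x; rewrite mul1n. Qed.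

Lemma vanish_wpt : vanish wt3 k (wpt (rhs k G)).
Proof.
apply: vanish_rci; first exact: vanish_u.
rewrite rhs_xu; apply: vanishD; first exact: vanish_xk.
exact: vanishW (leqnSn _) vanish_Gxu.
Qed.

Lemma vanish_pt i : vanish wt3 (wt2 i) (pt (rhs k G) i).
Proof. elim/ord2P: i; [exact: vanish_zpt|exact: vanish_wpt]. Qed.
Lemma pt0 i : pt (rhs k G) i 0%MM = 0.
Proof. exact: (vanish_pos (w2_gt0 i) (@vanish_pt i)). Qed.

End Hypersurface.

(** * The linear part of an invertible transformation *)

Section LinearPart.
Variables (K : fieldType).

Lemma coef_deriv0 n (a : fps n K) i : fps_deriv i a 0%MM = a U_(i)%MM.
Proof. by rewrite /fps_deriv mnm0E add0m. Qed.

(** The chain rule at the origin makes the Jacobian matrices inverse to each other; a zero below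
    the diagonal leaves nonzero diagonal entries. *)
Lemma invertible_linear (F P : 'I_2 -> fps 2 K) :
  (forall i, P i 0%MM = 0) -> (forall i, fsubst (F i) P = var i) ->
  F ju U_(jx)%MM = 0 -> F jx U_(jx)%MM != 0 /\ F ju U_(ju)%MM != 0.
Proof.
move=> P0 h h0.
have lin i j : F i U_(jx)%MM * P jx U_(j)%MM + F i U_(ju)%MM * P ju U_(j)%MM = (j == i)%:R.
  have := congr1 (fun a : fps 2 K => cst_coef (fps_deriv j a)) (h i).
  rewrite deriv_fsubst // sum2 rmorphD !rmorphM /= deriv_var rmorph_nat /cst_coef.
  by rewrite !fsubst_cst // !coef_deriv0.
have e1 := lin ju ju; rewrite h0 mul0r add0r /= in e1.
have hw : F ju U_(ju)%MM != 0.
  by apply/eqP => e; move: e1; rewrite e mul0r => /esym/eqP; rewrite oner_eq0.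
split=> //; have := lin ju jx; rewrite h0 mul0r add0r /= => /eqP.
rewrite mulf_eq0 (negbTE hw) /= => /eqP e2.
have := lin jx jx; rewrite e2 mulr0 addr0 /= => e3.
by apply/eqP => e; move: e3; rewrite e mul0r => /esym/eqP; rewrite oner_eq0.
Qed.
End LinearPart.

(** * Terms of lowest weight *)

Section Leading.
Variables (R : realType) (k : nat).
Hypothesis hk : (2 < k)%N.
Notation C := R[i].
Notation w2 := (wt2 k).
Notation w3 := (wt3 k).
Notation x := (var px : fps 3 R).
Notation y := (var py : fps 3 R).
Notation u := (var pu : fps 3 R).
Notation I := (fpsC ('i%C : C)).
Notation z := (zpt R).

Definition xy (N j : nat) : 'X_{1..3} := (U_(px) *+ (N - j) + U_(py) *+ j)%MM.

Lemma xy_inj N i j : (i <= N)%N -> (U_(px) *+ (N - i) + U_(py) *+ i)%MM = xy N j -> i = j.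
Proof.
by move=> _ /(congr1 (fun m : 'X_{1..3} => m py)); rewrite /xy !mnmDE !mulmnE !mnm1E /= !mul0n !mul1n.
Qed.

Lemma mwt_xy N j : (j <= N)%N -> mwt w3 (xy N j) = N.
Proof. by move=> h; rewrite /xy mwtD !mwtMn !mwtU /wt3 /=; lia. Qed.

Lemma zpt_mon : z = fpsC 1 * mon U_(px)%MM + I * mon U_(py)%MM.
Proof. by rewrite /zpt rmorph1 mul1r !varE !rc_mon. Qed.

Lemma zpt_coef N j : (j <= N)%N -> (z ^+ N) (xy N j) = 'C(N, j)%:R * 'i%C ^+ j.
Proof.
move=> h; rewrite zpt_mon (binomial_coef1 _ _ h (erefl _)) ?expr1n ?mulr1 //.
by move=> i; apply: xy_inj.
Qed.

Lemma real_coef (a b : R) N j : (j <= N)%N ->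
  ((fpsC a * x + fpsC b * y) ^+ N) (xy N j) = 'C(N, j)%:R * a ^+ (N - j) * b ^+ j.
Proof.
move=> h; rewrite !varE (binomial_coef1 _ _ h (erefl _)) //.
by move=> i; apply: xy_inj.
Qed.

Variables (G G' : fps 2 R) (f g : fps 2 C).
Hypotheses (hG : weight_gt k G) (hG' : weight_gt k G').
Hypothesis hG0 : forall l, G' (mn2 0 l) = 0.
Hypotheses (f0 : f 0%MM = 0) (g0 : g 0%MM = 0).
Let M := pt (rhs k G).
Hypothesis E : im (fsubst g M) =
  fsubst (rhs k G') (pair2 (re (fsubst f M)) (re (fsubst g M))).

Let M0 i : M i 0%MM = 0. Proof. exact: pt0. Qed.
Let vM i : vanish w3 (w2 i) (M i). Proof. exact: vanish_pt. Qed.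

Lemma vanish_f : vanish w2 1 f.
Proof.
apply/vanish2P => j l h; have -> : j = 0%N by lia. have -> : l = 0%N by nia.
by rewrite mn2_0.
Qed.

Lemma vanish_fM : vanish w3 1 (fsubst f M).
Proof. exact: (fsubst_vanish M0 vM vanish_f). Qed.

(** A lowest term beta z^N of g with N < k would be alone in Im g. Indeed, with the weights 1
    for x and N for u, each term of x^k + G' has weight above N: it is a power of x with
    exponent at least k, or it contains both x and u. So Im (beta z^N) = 0 for all x, y. *)
Lemma g_no_low_terms N : (0 < N <= k)%N -> vanish w2 N g.
Proof.
elim: N => // -[|N] IH hN.
  apply/vanish2P => j l h; have -> : j = 0%N by lia. have -> : l = 0%N by nia.
  by rewrite mn2_0.
have {}IH : vanish w2 N.+1 g by apply: IH; lia.
set beta := g (mn2 N.+1 0).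
have hg : vanish w2 N.+2 (g - fpsC beta * var jx ^+ N.+1).
  apply/vanish2P => j l h.
  have -> : l = 0%N by nia.
  have -> : var jx ^+ N.+1 = mon (mn2 N.+1 0) :> fps 2 C by rewrite mon2 expr0 mulr1.
  rewrite fpsBE fpsCM monE mn2_eq eqxx andbT.
  case: eqP => [->|hj]; first by rewrite mulr1 subrr.
  rewrite mulr0 subr0; apply: IH; rewrite mwt2; lia.
have hM : vanish w3 N.+2 (fsubst g M - fpsC beta * z ^+ N.+1).
  have := fsubst_vanish M0 vM hg; rewrite fsubstB // fsubstM // fsubstC //.
  by rewrite -[fsubst (_ ^+ _) _]/(subst M0 _) rmorphXn /= /subst fsubst_var.
have vU : vanish w3 N.+1 (re (fsubst g M)) by apply/re_vanish/(fsubst_vanish M0 vM IH).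
have vX : vanish w3 1 (re (fsubst f M)) by apply/re_vanish/vanish_fM.
have hR : vanish w3 N.+2 (im (fsubst g M)).
  rewrite E; apply: (fsubst_vanish (w := pair2 1%N N.+1) _).
  - by apply: ord2P; [apply: (vanish_pos _ vX)|apply: (vanish_pos _ vU)].
  - by apply: ord2P.
  apply/vanish2P => j l h; rewrite rhsE fpsDE.
  have -> : var jx ^+ k = mon (mn2 k 0) :> fps 2 R by rewrite mon2 expr0 mulr1.
  rewrite monE mn2_eq.
  case: l h => [|l] h.
    rewrite andbT (_ : (j == k) = false); last by lia.
    rewrite add0r; apply: (weight_vanish hk hG'); rewrite mwt2; lia.
  have [-> ->] : j = 0%N /\ l = 0%N by nia.
  by rewrite hG0 addr0 andbF.
have {hM hR} hb j : (j <= N.+1)%N -> complex.Im (beta * ('C(N.+1, j)%:R * 'i%C ^+ j)) = 0.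
  move=> hj; have hm : (mwt w3 (xy N.+1 j) < N.+2)%N by rewrite mwt_xy.
  have := im_vanish hM hm; rewrite raddfB /= fpsBE hR //= sub0r => /eqP.
  by rewrite oppr_eq0 /im fpsCM zpt_coef // => /eqP.
have b0 : beta = 0.
  have := hb 0%N isT; have := hb 1%N isT.
  rewrite bin0 bin1 expr0 !mulr1 expr1; case: (beta) => a b /=.
  rewrite -[N.+1%:R]/(N.+1%:R : C).
  have -> : (N.+1%:R : C) = (N.+1%:R%:C)%C by rewrite rmorph_nat.
  rewrite /= ?(mul0r, mulr0, mul1r, mulr1, subr0, sub0r, addr0, add0r, oppr0).
  by move=> /eqP; rewrite mulf_eq0 pnatr_eq0 orbF => /eqP -> ->.
by move: hg; rewrite b0 rmorph0 mul0r subr0.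
Qed.

Hypotheses (hfz : g U_(jx)%MM = 0 -> f U_(jx)%MM != 0).
Hypotheses (hgw : g U_(jx)%MM = 0 -> g U_(ju)%MM != 0).

(** The coefficients of y^0, ..., y^3 in Im (beta w + gamma z^k) = (Re alpha z)^k, where
    Re alpha z = a x + b y, gamma = c + id and B = Re beta. Those of y and y^3
    give a^(k-3) b (a^2 + b^2) = 0. If b were nonzero, then a = 0, and the coefficients of 1 and
    y^2 would give B = 0. *)
Lemma leading_system (a b B c d : R) :
  (forall j, (j <= 3)%N ->
     complex.Im ((c +i* d)%C * 'i%C ^+ j) + (j == 0%N)%:R * B = a ^+ (k - j) * b ^+ j) ->
  (a != 0 \/ b != 0) -> B != 0 -> [/\ b = 0, B = a ^+ k, c = 0 & d = 0].
Proof.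
move=> h hab hB.
have h0 := h 0%N isT; have h1 := h 1%N isT; have h2 := h 2%N isT; have h3 := h 3%N isT.
move: h0 h1 h2 h3 => {h}.
rewrite !exprS !expr0 /= ?(mul0r, mulr0, mul1r, mulr1, subr0, sub0r, addr0, add0r, oppr0, mulrN, mulrN1).
have [q ->] : exists q, k = q.+3 by exists (k - 3)%N; lia.
rewrite (_ : q.+3 - 1 = q.+2)%N; last lia.
rewrite (_ : q.+3 - 2 = q.+1)%N; last lia.
rewrite (_ : q.+3 - 3 = q)%N; last lia.
rewrite !exprS => h0 h1 h2 h3.
have e : a ^+ q * b * (a ^+ 2 + b ^+ 2) = 0.
  have -> : a ^+ q * b * (a ^+ 2 + b ^+ 2) = a * (a * a ^+ q) * b + a ^+ q * (b * (b * b)) by ring.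
  by rewrite -h1 -h3 ; ring.
have [b0|bn0] := eqVneq b 0.
  subst b; rewrite !mulr0 in h1 h2.
  have c0 : c = 0 by [].
  have d0 : d = 0 by lra.
  by split=> //; rewrite d0 add0r ?subn0 in h0.
exfalso; have hs : a ^+ 2 + b ^+ 2 != 0 by rewrite gt_eqF // ltr_wpDl ?sqr_ge0 // exprn_even_gt0.
move/eqP: e; rewrite !mulf_eq0 (negbTE bn0) (negbTE hs) !orbF expf_eq0 => /andP[q0 /eqP a0].
subst a; move: h0 h2; rewrite !mul0r => h0 h2.
have d0 : d = 0 by lra.
by move/eqP: hB; apply; rewrite d0 in h0; lra.
Qed.

Lemma leading_terms : exists2 alpha : R, alpha != 0 &
  vanish w2 2 (f - fpsC (alpha%:C)%C * var jx) /\
  vanish w2 k.+1 (g - fpsC ((alpha ^+ k)%:C)%C * var ju).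
Proof.
have vg : vanish w2 k g by apply: g_no_low_terms; rewrite leqnn andbT; lia.
have gz0 : g U_(jx)%MM = 0 by apply: vg; rewrite mwtU /wt2 pair2x; lia.
have fz := hfz gz0; have gw := hgw gz0.
set alpha := f U_(jx)%MM in fz *; set beta := g U_(ju)%MM in gw *.
set gamma := g (mn2 k 0).
have hf : vanish w2 2 (f - fpsC alpha * var jx).
  apply/vanish2P => j l h; have -> : l = 0%N by nia.
  rewrite varE -mn2_10 fpsBE fpsCM monE mn2_eq andbT.
  case: eqP => [->|hj]; first by rewrite mulr1 mn2_10 subrr.
  rewrite mulr0 subr0 (_ : j = 0%N); last by lia.
  by rewrite mn2_0.
have hg : vanish w2 k.+1 (g - (fpsC beta * var ju + fpsC gamma * var jx ^+ k)).
  apply/vanish2P => j l h.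
  have -> : var jx ^+ k = mon (mn2 k 0) :> fps 2 C by rewrite mon2 expr0 mulr1.
  rewrite varE -mn2_01 fpsBE fpsDE !fpsCM !monE !mn2_eq.
  have [->|hl] := eqVneq l 0%N.
    rewrite andbF mulr0 add0r andbT.
    case: eqP => [->|hj]; first by rewrite mulr1 subrr.
    rewrite mulr0 subr0; apply: vg; rewrite mwt2; lia.
  have [-> ->] : j = 0%N /\ l = 1%N by nia.
  rewrite eqxx mulr1 (_ : (0%N == k) && _ = false); last by rewrite andbF.
  by rewrite mulr0 addr0 mn2_01 subrr.
set a := complex.Re alpha; set b := - complex.Im alpha.
have hX : vanish w3 2 (re (fsubst f M) - (fpsC a * x + fpsC b * y)).
  have -> : fpsC a * x + fpsC b * y = re (fpsC alpha * z).
    rewrite reM re_C im_C /zpt reE imE /a /b rmorphN; ring.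
  rewrite -raddfB; apply: re_vanish; have := fsubst_vanish M0 vM hf.
  by rewrite fsubstB // fsubstM // fsubstC // fsubst_var.
have vU : vanish w3 k (re (fsubst g M)) by apply/re_vanish/(fsubst_vanish M0 vM vg).
have vX : vanish w3 1 (re (fsubst f M)) by apply/re_vanish/vanish_fM.
have XU0 i : pair2 (re (fsubst f M)) (re (fsubst g M)) i 0%MM = 0.
  elim/ord2P: i; [exact: (vanish_pos _ vX)|apply: (vanish_pos _ vU); lia].
have hR : vanish w3 k.+1 (im (fsubst g M) - (fpsC a * x + fpsC b * y) ^+ k).
  rewrite E fsubst_rhs // addrAC; apply: vanishD; last first.
    apply: (fsubst_vanish XU0 _ (weight_vanish hk hG')).
    by apply: ord2P.
  rewrite pair2x; set X := re _ in hX vX *; set Y := fpsC a * x + _ in hX *.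
  have vY : vanish w3 1 Y.
    by rewrite -[Y](subKr X); apply: vanishB => //; apply: vanishW hX.
  have [] := @vanish_prod _ R w3 1 _ (fun=> 1%N) [:: tt] (fun=> k) (fun=> X) (fun=> Y) => //.
  by rewrite !big_seq1 mul1n addn1.
have hL : vanish w3 k.+1 (fsubst g M - (fpsC beta * M ju + fpsC gamma * z ^+ k)).
  have := fsubst_vanish M0 vM hg.
  rewrite -[fsubst (_ - _) _]/(subst M0 _) rmorphB rmorphD !rmorphM rmorphXn.
  by rewrite /= /subst !fsubstC // !fsubst_var.
have hT : vanish w3 k.+1 (fpsC (complex.Im beta) * u + fpsC (complex.Re beta) * x ^+ k
   + im (fpsC gamma * z ^+ k) - (fpsC a * x + fpsC b * y) ^+ k).
  have h1 := im_vanish hL; rewrite raddfB raddfD /= in h1.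
  have e : im (fpsC beta * M ju) = fpsC (complex.Im beta) * u +
      fpsC (complex.Re beta) * x ^+ k + fpsC (complex.Re beta) * fsubst G (xu_pt R).
    rewrite imM re_C im_C /M /pt pair2u /wpt reE imE rhs_xu //; ring.
  have h2 := vanishB hR h1.
  have h3 : vanish w3 k.+1 (fpsC (complex.Re beta) * fsubst G (xu_pt R)).
    by apply: vanishMl; exact: (vanish_Gxu hk hG).
  have := vanishB h2 h3; rewrite e; congr (vanish _ _ _); ring.
have xkE : x ^+ k = mon (xy k 0) by rewrite /xy subn0 mulm0n addm0 monX.
have xy_u N j : (j <= N)%N -> (xy N j == U_(pu)%MM) = false.
  move=> _; apply/eqP => /(congr1 (fun m : 'X_{1..3} => m pu)).
  by rewrite /xy !mnmDE !mulmnE !mnm1E.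
have hu (p q : C) : ((fpsC p * mon U_(px)%MM + fpsC q * mon U_(py)%MM) ^+ k) U_(pu)%MM = 0.
  rewrite binomial_coef big1 // => i _; rewrite eq_sym xy_u ?mulr0 //.
  by rewrite -ltnS.
have hur (p q : R) : ((fpsC p * mon U_(px)%MM + fpsC q * mon U_(py)%MM) ^+ k) U_(pu)%MM = 0.
  rewrite binomial_coef big1 // => i _; rewrite eq_sym xy_u ?mulr0 //.
  by rewrite -ltnS.
have ib : complex.Im beta = 0.
  have := hT U_(pu)%MM; rewrite mwtU /wt3 eqxx ltnSn => /(_ isT).
  rewrite fpsBE !fpsDE !fpsCM xkE !varE !monE eqxx mulr1 eq_sym xy_u // mulr0 addr0.
  by rewrite hur subr0 /im fpsCM zpt_mon hu mulr0 addr0.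
(* The coefficient of x^(k - j) y^j, divided by the binomial coefficient. *)
have sys j : (j <= 3)%N ->
     complex.Im (gamma * 'i%C ^+ j) + (j == 0%N)%:R * complex.Re beta = a ^+ (k - j) * b ^+ j.
  move=> hj3; have hj : (j <= k)%N by exact: leq_trans hj3 hk.
  have hm : (mwt w3 (xy k j) < k.+1)%N by rewrite mwt_xy.
  have := hT _ hm.
  rewrite fpsBE !fpsDE !fpsCM ib mul0r add0r xkE monE real_coef // /im fpsCM zpt_coef //.
  have -> : (xy k j == xy k 0) = (j == 0%N).
    apply/eqP/eqP => [|->] // /(congr1 (fun m : 'X_{1..3} => m py)).
    by rewrite /xy !mnmDE !mulmnE !mnm1E /= !mul0n !mul1n.
  have -> : gamma * ('C(k, j)%:R * 'i%C ^+ j) = (('C(k, j)%:R)%:C)%C * (gamma * 'i%C ^+ j).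
    by rewrite rmorph_nat; ring.
  have -> (r : R) (c : C) : complex.Im ((r%:C)%C * c) = r * complex.Im c.
    by case: c => p q; rewrite /= mul0r addr0.
  have hC : ('C(k, j)%:R : R) != 0 by rewrite pnatr_eq0 -lt0n bin_gt0.
  move/eqP; rewrite subr_eq0 => /eqP e; apply: (mulfI hC); rewrite [RHS]mulrA -e.
  by case: eqP => [->|_]; rewrite ?bin0 ?mulr1n ?mulr0n; ring.
have rb : complex.Re beta != 0.
  by move: gw ib; case: (beta) => p q /=; rewrite eq_complex negb_and /= => /orP[//|/eqP hq /hq].
have ab : a != 0 \/ b != 0.
  by move: fz; rewrite /a /b oppr_eq0; case: (alpha) => p q /=; rewrite eq_complex negb_and => /orP.
case: (gamma) hg sys => c d hg sys.
have [b0 B c0 d0] := leading_system sys ab rb.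
have ealpha : alpha = (a%:C)%C.
  by move: b0; rewrite /a /b; case: (alpha) => p q /= /eqP; rewrite oppr_eq0 => /eqP ->.
have ebeta : beta = ((a ^+ k)%:C)%C.
  by rewrite -B; move: ib; case: (beta) => p q /= ->.
exists a; first by case: ab => //; rewrite b0 eqxx.
rewrite -ealpha -ebeta; split => //.
by move: hg; rewrite c0 d0 -[Complex 0 0]/(0 : C) rmorph0 mul0r addr0.
Qed.
End Leading.

(** * Coefficients of products with monomials *)

Section MonMul.
Variable (K : comNzRingType).

Lemma mon_mulE n (m m' : 'X_{1..n}) (a : fps n K) : (mon m * a) (m + m')%MM = a m'.
Proof.
rewrite (fpsME _ _ (leqnn _)); set N := mdeg _.
have -> : fps_trunc (mon m) N = 'X_[m] :> {mpoly K[n]}.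
  apply/mpolyP => q; rewrite fps_truncE monE mcoeffX eq_sym.
  case: ifP => // h; case: eqP => // e; move: h.
  by rewrite -e /N mdegD leq_addr.
by rewrite mulrC mcoeffMX fps_truncE /N mdegD leq_addl.
Qed.

Lemma var_u_mul q (a : fps 2 K) i j :
  (var ju ^+ q * a) (mn2 i j) = if (q <= j)%N then a (mn2 i (j - q)) else 0.
Proof.
have -> : var ju ^+ q = mon (mn2 0 q) :> fps 2 K by rewrite mon2 expr0 mul1r.
case: leqP => h.
  have -> : mn2 i j = (mn2 0 q + mn2 i (j - q))%MM; last exact: mon_mulE.
  by apply/mnmP; apply: ord2P; rewrite mnmDE ?mn2_x ?mn2_u // subnKC.
apply: (vanishMr (w := pair2 0%N 1%N) (N := q)); last by rewrite mwt2; lia.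
by have := @vanish_mon 2 K (pair2 0%N 1%N) (mn2 0 q); rewrite mwt2 mul1n.
Qed.

(** The exponents of X that occur are the multiples of k; this separates the terms on the Segre
    set. *)
Lemma fsubst_power_coef k c (a : fps 2 K) i j : (0 < k)%N ->
  fsubst a (pair2 (var jx) (fpsC c * var ju ^+ k)) (mn2 i j) =
  if (k %| j)%N then a (mn2 i (j %/ k)) * c ^+ (j %/ k) else 0.
Proof.
move=> k0; pose cc : 'I_2 -> K := pair2 1 c; pose e : 'I_2 -> 'X_{1..2} := pair2 (mn2 1 0) (mn2 0 k).
have -> : pair2 (var jx) (fpsC c * var ju ^+ k) = (fun t => fpsC (cc t) * mon (e t)) :> ('I_2 -> fps 2 K).
  apply: funext; apply: ord2P; rewrite /cc /e ?(pair2x, pair2u) mon2 ?expr0 ?mul1r //.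
  by rewrite rmorph1 mul1r expr1 mulr1.
have he t : e t != 0%MM.
  elim/ord2P: t; rewrite /e ?(pair2x, pair2u) -mn2_0 mn2_eq //=.
  by rewrite -lt0n.
have hs (m' : 'X_{1..2}) : (\sum_t e t *+ m' t)%MM = mn2 (m' jx) (k * m' ju).
  rewrite summ2 /e pair2x pair2u; apply/mnmP; apply: ord2P;
  by rewrite mnmDE !mulmnE ?mn2_x ?mn2_u; lia.
case: ifP => hj.
  have -> : mn2 i j = (\sum_t e t *+ (mn2 i (j %/ k)) t)%MM.
    by rewrite hs mn2_x mn2_u mulnC divnK.
  rewrite fsubst_monomial_in //; first by rewrite prod2 /cc pair2x pair2u expr1n mul1r mn2_u.
  move=> m1 m2; rewrite /= !hs => /eqP; rewrite mn2_eq => /andP[/eqP e1 /eqP e2].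
  rewrite (mnm2E m1) (mnm2E m2) e1; congr mn2; nia.
rewrite fsubst_monomial_out // => m'; rewrite hs mn2_eq; apply/negP => /andP[_ /eqP ej].
by move: hj; rewrite ej dvdn_mulr.
Qed.

Lemma fsubst_scale_coef c d (a : fps 2 K) i j :
  fsubst a (pair2 (fpsC c * var jx) (fpsC d * var ju)) (mn2 i j) =
  a (mn2 i j) * (c ^+ i * d ^+ j).
Proof.
pose cc : 'I_2 -> K := pair2 c d; pose e : 'I_2 -> 'X_{1..2} := fun t => U_(t)%MM.
have -> : pair2 (fpsC c * var jx) (fpsC d * var ju) = (fun t => fpsC (cc t) * mon (e t)) :> ('I_2 -> fps 2 K).
  by apply: funext; apply: ord2P.
have hs (m' : 'X_{1..2}) : (\sum_t e t *+ m' t)%MM = m'.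
  by rewrite summ2 [RHS]mnm2E.
rewrite -{1}(hs (mn2 i j)) fsubst_monomial_in //.
- by rewrite prod2 /cc pair2x pair2u mn2_x mn2_u.
- by move=> t; rewrite /e mnm1_eq0.
- by move=> m1 m2; rewrite !hs.
Qed.

(** Substitution of (X, c X^k) for the variables: the result does not contain Z. *)
Lemma fsubst_diag_coef k c (a : fps 2 K) i j : (0 < k)%N -> (0 < i)%N ->
  fsubst a (pair2 (var ju) (fpsC c * var ju ^+ k)) (mn2 i j) = 0.
Proof.
move=> k0 i0; pose cc : 'I_2 -> K := pair2 1 c; pose e : 'I_2 -> 'X_{1..2} := pair2 (mn2 0 1) (mn2 0 k).
have -> : pair2 (var ju) (fpsC c * var ju ^+ k) = (fun t => fpsC (cc t) * mon (e t)) :> ('I_2 -> fps 2 K).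
  apply: funext; apply: ord2P; rewrite /cc /e ?(pair2x, pair2u) mon2 ?expr0 ?mul1r //.
  by rewrite rmorph1 mul1r expr1.
apply: fsubst_monomial_out => [|m'].
  apply: ord2P; rewrite /e ?(pair2x, pair2u) -mn2_0 mn2_eq //=.
  by rewrite -lt0n.
rewrite summ2 /e pair2x pair2u; apply/eqP => /(congr1 (fun m : 'X_{1..2} => m jx)) h.
have : mn2 i j jx = (mn2 0 1 *+ m' jx + mn2 0 k *+ m' ju)%MM jx by [].
by rewrite mnmDE !mulmnE !mn2_x mul0n; lia.
Qed.

Lemma binomial2_coef (p q : K) n i j : (i + j = n)%N ->
  ((fpsC p * var jx + fpsC q * var ju) ^+ n) (mn2 i j) = 'C(n, j)%:R * p ^+ i * q ^+ j.
Proof.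
move=> e; have ei : (n - j = i)%N by lia.
rewrite !varE (@binomial_coef1 K 2 U_(jx)%MM U_(ju)%MM _ p q n j) ?ei //; first by lia.
move=> t _ /(congr1 (fun m : 'X_{1..2} => m ju)).
by rewrite mn2_u mnmDE !mulmnE !mnm1E /= mul0n mul1n.
Qed.

(** Taylor expansion of a power to first order. The remainder contains r^2, whose order
    2N + 2 puts it beyond the linear term. *)
Lemma pow_taylor n w (a r : fps n K) N j : vanish w 1 a -> vanish w N.+1 r ->
  vanish w (j.+1 + 2 * N) ((a + r) ^+ j.+1 - a ^+ j.+1 - j.+1%:R * a ^+ j * r).
Proof.
move=> ha hr; elim: j => [|j IH].
  have -> : (a + r) ^+ 1 - a ^+ 1 - 1%:R * a ^+ 0 * r = 0 by ring.
  exact: vanish0.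
have -> : (a + r) ^+ j.+2 - a ^+ j.+2 - j.+2%:R * a ^+ j.+1 * r =
  (a + r) * ((a + r) ^+ j.+1 - a ^+ j.+1 - j.+1%:R * a ^+ j * r) + j.+1%:R * (a ^+ j * (r * r)).
  by rewrite -[j.+2%:R]natr1 !exprS; ring.
apply: vanishD.
  rewrite addSn -add1n; apply: vanishM IH; apply: vanishD ha _.
  exact: vanishW hr.
apply: vanishMl; apply: (@vanishW _ _ _ (1 * j + (N.+1 + N.+1))); first by lia.
by apply: vanishM; [apply: vanishX|apply: vanishM].
Qed.
End MonMul.

(** * The linearized equation *)

Section Linearization.
Variables (R : realType) (k : nat).
Hypothesis hk : (2 < k)%N.
Notation C := R[i].
Notation w2 := (wt2 k).
Notation w3 := (wt3 k).
Notation x := (var px : fps 3 R).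
Notation u := (var pu : fps 3 R).
Notation z := (zpt R).
Notation xu := (xu_pt R).

Definition model_w : fps 3 C := rc u + fpsC 'i%C * rc (x ^+ k).
Definition model_pt : 'I_2 -> fps 3 C := pair2 z model_w.

Lemma vanish_model_pt i : vanish w3 (w2 i) (model_pt i).
Proof.
elim/ord2P: i; first exact: vanish_zpt.
exact: (vanish_rci (@vanish_u R k) (@vanish_xk R k)).
Qed.
Lemma model_pt0 i : model_pt i 0%MM = 0.
Proof. exact: (vanish_pos (w2_gt0 hk i) (@vanish_model_pt i)). Qed.

Section Linearize.
Variables (G G' : fps 2 R) (f1 g1 : fps 2 C) (alpha : R) (N : nat).
Hypotheses (hG : weight_gt k G) (hG' : weight_gt k G') (hN : (0 < N)%N).
Hypotheses (hf1 : vanish w2 N.+1 f1) (hg1 : vanish w2 (N + k) g1).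
Let M := pt (rhs k G).
Let f := fpsC (alpha%:C)%C * var jx + f1.
Let g := fpsC ((alpha ^+ k)%:C)%C * var ju + g1.
Hypothesis E : im (fsubst g M) =
  fsubst (rhs k G') (pair2 (re (fsubst f M)) (re (fsubst g M))).

(** The difference of the two right-hand sides after the dilation of ratio a; it inherits the
    normal form conditions. *)
Definition hdiff (a : R) (H H' : fps 2 R) : fps 2 R :=
  fsubst H' (pair2 (fpsC a * var jx) (fpsC (a ^+ k) * var ju)) - fpsC (a ^+ k) * H.

Let M0 i : M i 0%MM = 0. Proof. exact: (pt0 hk hG). Qed.
Let vM i : vanish w3 (w2 i) (M i). Proof. exact: (vanish_pt hk hG). Qed.

(** Everything is taken modulo weight N + k + 1. Moving the point from the hypersurface to the
    model v = x^k changes f1 and g1 by terms of higher weight; (Re f)^k contributes its first-order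
    Taylor term; and G' only has terms of weight above k, so it does not see the deviation of
    relative weight N. *)
Lemma linearize :
  vanish w3 (N + k).+1 (im (fsubst g1 model_pt)
     - fpsC (k%:R * alpha ^+ k.-1) * x ^+ k.-1 * re (fsubst f1 model_pt)
     - fsubst (hdiff alpha G G') xu).
Proof.
have vMmp i : vanish w3 (w2 i + 1) (M i - model_pt i).
  elim/ord2P: i; rewrite /M /model_pt /pt ?(pair2x, pair2u); first by rewrite subrr.
  have -> : wpt (rhs k G) - model_w = fpsC 'i%C * rc (fsubst G xu).
    by rewrite /wpt /model_w (rhs_xu hk) // rmorphD /=; ring.
  by rewrite addn1; apply: vanishMl; apply: rc_vanish; apply: (vanish_Gxu hk hG).
have cmp a d : vanish w2 d a -> vanish w3 d.+1 (fsubst a M - fsubst a model_pt).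
  move=> ha; rewrite -(addn1 d).
  exact: (fsubst_congr M0 model_pt0 vM (@vanish_model_pt) vMmp ha).
set rA := re (fsubst f1 M); set rB := re (fsubst g1 M).
have eX : re (fsubst f M) = fpsC alpha * x + rA.
  have -> : fsubst f M = rc (fpsC alpha) * z + fsubst f1 M.
    rewrite /f -[LHS]/(subst M0 _) rmorphD rmorphM /= /subst fsubstC // fsubst_var //.
    by rewrite rcC.
  by rewrite raddfD /= re_rcM /zpt reE.
have eU : re (fsubst g M) = fpsC (alpha ^+ k) * u + rB.
  have -> : fsubst g M = rc (fpsC (alpha ^+ k)) * M ju + fsubst g1 M.
    rewrite /g -[LHS]/(subst M0 _) rmorphD rmorphM /= /subst fsubstC // fsubst_var //.
    by rewrite rcC.
  by rewrite raddfD /= re_rcM /M /pt pair2u /wpt reE.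
have eI : im (fsubst g M) = fpsC (alpha ^+ k) * (x ^+ k + fsubst G xu) + im (fsubst g1 M).
  have -> : fsubst g M = rc (fpsC (alpha ^+ k)) * M ju + fsubst g1 M.
    rewrite /g -[LHS]/(subst M0 _) rmorphD rmorphM /= /subst fsubstC // fsubst_var //.
    by rewrite rcC.
  by rewrite raddfD /= im_rcM /M /pt pair2u /wpt imE (rhs_xu hk).
have vrA : vanish w3 N.+1 rA by apply/re_vanish/(fsubst_vanish M0 vM hf1).
have vrB : vanish w3 (N + k) rB by apply/re_vanish/(fsubst_vanish M0 vM hg1).
have vax : vanish w3 1 (fpsC alpha * x) by apply/vanishMl/vanish_x.
have vau : vanish w3 k (fpsC (alpha ^+ k) * u) by apply/vanishMl/vanish_u.
pose s0 : 'I_2 -> fps 3 R := pair2 (fpsC alpha * x) (fpsC (alpha ^+ k) * u).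
pose s1 : 'I_2 -> fps 3 R := pair2 (fpsC alpha * x + rA) (fpsC (alpha ^+ k) * u + rB).
have vs0 i : vanish w3 (w2 i) (s0 i) by elim/ord2P: i.
have vs1 i : vanish w3 (w2 i) (s1 i).
  elim/ord2P: i; apply: vanishD => //; [exact: vanishW vrA|apply: vanishW vrB].
  by rewrite /wt2 pair2u leq_addl.
have s00 i : s0 i 0%MM = 0 by apply: (vanish_pos (w2_gt0 hk i) (@vs0 i)).
have s10 i : s1 i 0%MM = 0 by apply: (vanish_pos (w2_gt0 hk i) (@vs1 i)).
(* T1 and T3 account for the change of point in g1 and f1, T2 for the Taylor remainder of the
   k-th power, T4 for the deviation of the arguments of G'. *)
have T4 : vanish w3 (N + k).+1 (fsubst G' s1 - fsubst G' s0).
  have -> : ((N + k).+1 = k.+1 + N)%N by lia.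
  apply: (fsubst_congr s10 s00 vs1 vs0 _ (weight_vanish hk hG')).
  apply: ord2P; rewrite /s1 /s0 /wt2 ?(pair2x, pair2u) addrAC subrr add0r.
    by rewrite add1n.
  by rewrite addnC.
have es0 : fsubst G' s0 - fpsC (alpha ^+ k) * fsubst G xu = fsubst (hdiff alpha G G') xu.
  pose sc : 'I_2 -> fps 2 R := pair2 (fpsC alpha * var jx) (fpsC (alpha ^+ k) * var ju).
  have sc0 i : sc i 0%MM = 0.
    by elim/ord2P: i; rewrite /sc ?(pair2x, pair2u) fpsCM var0 mulr0.
  have xu0 := @xu0 R k hk.
  rewrite /hdiff fsubstB // fsubstM // fsubstC // fsubstA //; congr (fsubst _ _ - _).
  apply: funext; apply: ord2P; rewrite /s0 /sc ?(pair2x, pair2u) fsubstM // fsubstC //.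
    by rewrite fsubst_var.
  by rewrite fsubst_var.
have T1 : vanish w3 (N + k).+1 (im (fsubst g1 M) - im (fsubst g1 model_pt)).
  by rewrite -raddfB; apply/im_vanish/cmp.
have ek : k = k.-1.+1 by lia.
have T2 : vanish w3 (N + k).+1 ((fpsC alpha * x + rA) ^+ k - (fpsC alpha * x) ^+ k
    - k%:R * (fpsC alpha * x) ^+ k.-1 * rA).
  have := @pow_taylor R 3 w3 _ _ N k.-1 vax vrA; rewrite -ek; apply: vanishW; lia.
have T3 : vanish w3 (N + k).+1 (k%:R * (fpsC alpha * x) ^+ k.-1 * (rA - re (fsubst f1 model_pt))).
  rewrite -mulrA; apply: vanishMl; apply: (@vanishW _ _ _ (1 * k.-1 + N.+2)); first by lia.
  apply: vanishM; first exact: vanishX.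
  by rewrite /rA -raddfB; apply/re_vanish/cmp.
have E1 := E; rewrite eX eU fsubst_rhs // in E1.
rewrite eI pair2x -/s1 in E1.
have := vanishD (vanishB T2 T1) (vanishD T3 T4); congr (vanish _ _ _).
have e1 : fpsC (k%:R * alpha ^+ k.-1) = k%:R * fpsC alpha ^+ k.-1 :> fps 3 R.
  by rewrite rmorphM rmorph_nat rmorphXn.
have e3 : fpsC (alpha ^+ k) = fpsC alpha ^+ k :> fps 3 R by rewrite rmorphXn.
rewrite -es0 e1.
have e2 : im (fsubst g1 M) = (fpsC alpha * x + rA) ^+ k + fsubst G' s1
  - fpsC (alpha ^+ k) * (x ^+ k + fsubst G xu) by rewrite -E1; ring.
rewrite e2 e3 !exprMn; ring.
Qed.
End Linearize.
End Linearization.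

(** * The linearized equation on a Segre set *)

Lemma ord3P (P : 'I_3 -> Prop) : P px -> P py -> P pu -> forall i, P i.
Proof.
move=> h0 h1 h2 [[|[|[|i]]] hi] //.
- by have -> : Ordinal hi = px by exact: val_inj.
- by have -> : Ordinal hi = py by exact: val_inj.
- by have -> : Ordinal hi = pu by exact: val_inj.
Qed.

Section Kernel.
Variables (R : realType) (k : nat).
Hypothesis hk : (2 < k)%N.
Notation C := R[i].
Notation w2 := (wt2 k).
Notation w3 := (wt3 k).
Notation x := (var px : fps 3 R).
Notation y := (var py : fps 3 R).
Notation u := (var pu : fps 3 R).
Notation z := (zpt R).
Notation xu := (xu_pt R).
Notation mp := (model_pt R k).
Notation w0 := (model_w R k).
Notation II := (fpsC ('i%C : C)).

Variables (f1 g1 : fps 2 C) (h : fps 2 R) (kappa : R) (N : nat).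
Hypotheses (hf1 : vanish w2 N.+1 f1) (hg1 : vanish w2 (N + k) g1).
Hypothesis hlin : vanish w3 (N + k).+1
  (im (fsubst g1 mp) - fpsC kappa * x ^+ k.-1 * re (fsubst f1 mp) - fsubst h xu).

Notation Z := (var jx : fps 2 C).
Notation X := (var ju : fps 2 C).
Notation wd := (@wdeg 2).

(** Complex values of x, y, u for which z = x + iy becomes the variable Z, the conjugate x - iy
    becomes 2X - Z, the conjugate u - i x^k of w becomes 0 and w becomes 2i X^k. *)
Definition segre_pt (i : 'I_3) : fps 2 C :=
  if i == px then X else if i == py then - II * (Z - X) else II * X ^+ k.

Lemma vanish_segre_pt i : vanish wd (w3 i) (segre_pt i).
Proof.
have vZ : vanish wd 1 Z by exact: vanish_var.
have vX : vanish wd 1 X by exact: vanish_var.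
elim/ord3P: i; rewrite /segre_pt /wt3 /= //; first exact/vanishMl/vanishB.
by apply: vanishMl; have := @vanishX _ _ _ _ _ k vX; rewrite mul1n.
Qed.
Lemma segre_pt0 i : segre_pt i 0%MM = 0.
Proof.
apply: (vanish_pos _ (@vanish_segre_pt i)); rewrite /wt3; case: ifP => // _; lia.
Qed.

Local Notation S := (subst segre_pt0).

Let S_var i : S (var i) = segre_pt i. Proof. exact: fsubst_var segre_pt0. Qed.
Let S_C c : S (fpsC c) = fpsC c. Proof. exact: fsubstC segre_pt0 _. Qed.

Let rcx i : rc (var i : fps 3 R) = var i. Proof. by rewrite varE rc_mon. Qed.
Let I2 : II * II = -1 :> fps 2 C.
Proof. by rewrite -rmorphM -expr2 sqr_i rmorphN rmorph1. Qed.

Let Szw : S z = Z /\ S (cj z) = 2%:R * X - Z.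
Proof.
have e1 : S (rc x) = X by rewrite rcx S_var.
have e2 : S (rc y) = - II * (Z - X) by rewrite rcx S_var.
have -> : cj z = rc x - II * rc y by rewrite cjE /zpt reE imE.
rewrite /zpt rmorphD rmorphB rmorphM /= e1 e2 S_C.
split.
  transitivity (X - (II * II) * (Z - X)); first by ring.
  by rewrite I2; ring.
transitivity (X + (II * II) * (Z - X)); first by ring.
by rewrite I2; ring.
Qed.

Let Sw0 : S w0 = fpsC (2%:R * 'i%C) * X ^+ k /\ S (cj w0) = 0.
Proof.
have e1 : S (rc x) = X by rewrite rcx S_var.
have e2 : S (rc u) = II * X ^+ k by rewrite rcx S_var.
have -> : cj w0 = rc u - II * rc (x ^+ k) by rewrite cjE /model_w reE imE.
rewrite /model_w rmorphD rmorphB rmorphM rmorphXn rmorphXn /= e1 e2 S_C.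
by split; [rewrite rmorphM rmorph_nat|]; ring.
Qed.

Let cjmp0 i : cj (mp i) 0%MM = 0.
Proof. by rewrite /cj /fps_map model_pt0 // raddf0. Qed.

Let S_fsubst (a : fps 2 C) (b : 'I_2 -> fps 3 C) : (forall i, b i 0%MM = 0) ->
  S (fsubst a b) = fsubst a (pair2 (S (b jx)) (S (b ju))).
Proof.
move=> b0; rewrite -[LHS]/(fsubst (fsubst a b) segre_pt) (fsubstA _ b0 segre_pt0).
by congr fsubst; apply: funext; apply: ord2P.
Qed.

Let Sh : S (rc (fsubst h xu)) = fsubst (rc h) (pair2 X (II * X ^+ k)).
Proof.
have xu0 := @xu0 R k hk; rewrite rc_fsubst // S_fsubst.
  congr (fsubst _ (pair2 _ _)).
    by rewrite -[LHS]/(S (rc x)) rcx S_var.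
  by rewrite -[LHS]/(S (rc u)) rcx S_var.
by move=> i; rewrite /rc /fps_map xu0 raddf0.
Qed.

Let Pg := fsubst g1 (pair2 Z (fpsC (2%:R * 'i%C) * X ^+ k)).
Let Pf := fsubst f1 (pair2 Z (fpsC (2%:R * 'i%C) * X ^+ k)).
Let gc := g1 (mn2 (N + k) 0).
Let fc := f1 (mn2 N.+1 0).

(** On the Segre set the conjugate of w is 0, so only the pure power of z in the lowest part of a
    survives. In the proof the second variable gets the weight d + 1, which discards all terms
    that contain it. *)
Lemma conj_part d (a : fps 2 C) : vanish w2 d a ->
  vanish wd d.+1 (S (cj (fsubst a mp)) - fpsC (conjc (a (mn2 d 0))) * (2%:R * X - Z) ^+ d).
Proof.
move=> ha.
have -> : S (cj (fsubst a mp)) = fsubst (cj a) (pair2 (2%:R * X - Z) 0).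
  have -> : cj (fsubst a mp) = fsubst (cj a) (fun i => cj (mp i)).
    by apply: fps_map_fsubst; apply: model_pt0.
  rewrite (S_fsubst _ cjmp0); congr (fsubst _ (pair2 _ _)); rewrite /model_pt ?(pair2x, pair2u).
    by case: Szw.
  by case: Sw0.
set b := pair2 _ _.
have vb i : vanish wd (pair2 1%N d.+1 i) (b i).
  elim/ord2P: i; rewrite /b ?(pair2x, pair2u); last exact: vanish0.
  by apply: vanishB; [apply: vanishMl|]; apply: vanish_var.
have b0 i : b i 0%MM = 0 by elim/ord2P: i; apply: (vanish_pos _ (@vb _)).
have := @fsubst_vanish _ _ _ b b0 wd (pair2 1%N d.+1) d.+1 (cj a - fpsC (a (mn2 d 0))^*%C * Z ^+ d) vb.
rewrite fsubstB // fsubstM // fsubstC // -[fsubst (Z ^+ d) b]/(subst b0 _) rmorphXn /= /subst fsubst_var //.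
apply; apply/vanish2P => i j hij; have -> : j = 0%N by nia.
have -> : Z ^+ d = mon (mn2 d 0) by rewrite mon2 expr0 mulr1.
rewrite fpsBE fpsCM monE mn2_eq eqxx andbT /cj /fps_map.
case: eqP => [->|hi]; first by rewrite mulr1 subrr.
rewrite mulr0 subr0 (ha (mn2 i 0)) ?raddf0 // mwt2; nia.
Qed.

(** Twice i times the imaginary part is a difference of conjugates, and twice the real part is a
    sum; both are polynomial in x, y, u, so the equation may be evaluated at complex values. *)
Lemma complexified :
  vanish wd (N + k).+1 (Pg - II * fpsC (kappa%:C)%C * (X ^+ k.-1 * Pf)
   - (fpsC (conjc gc) * (2%:R * X - Z) ^+ (N + k)
      + II * fpsC (kappa%:C)%C * (X ^+ k.-1 * (fpsC (conjc fc) * (2%:R * X - Z) ^+ N.+1)))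
   - 2%:R * II * fsubst (rc h) (pair2 X (II * X ^+ k))).
Proof.
have hl := hlin; set A := fsubst f1 mp in hl *; set B := fsubst g1 mp in hl *.
have SA : S A = Pf.
  rewrite /A S_fsubst; last exact: model_pt0.
  by congr (fsubst _ (pair2 _ _)); rewrite /model_pt ?(pair2x, pair2u); [case: Szw|case: Sw0].
have SB : S B = Pg.
  rewrite /B S_fsubst; last exact: model_pt0.
  by congr (fsubst _ (pair2 _ _)); rewrite /model_pt ?(pair2x, pair2u); [case: Szw|case: Sw0].
have h1 := vanishMl (2%:R * II) (rc_vanish hl).
have h2 := fsubst_vanish segre_pt0 (@vanish_segre_pt) h1.
rewrite -[fsubst _ segre_pt]/(S _) in h2.
have e : 2%:R * II * rc (im B - fpsC kappa * x ^+ k.-1 * re A - fsubst h xu) =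
   (B - cj B) - II * rc (fpsC kappa * x ^+ k.-1) * (A + cj A) - 2%:R * II * rc (fsubst h xu).
  by rewrite im_cj re_cj !rmorphB !rmorphM /=; ring.
have eS : S (2%:R * II * rc (im B - fpsC kappa * x ^+ k.-1 * re A - fsubst h xu)) =
  (Pg - S (cj B)) - II * (fpsC (kappa%:C)%C * X ^+ k.-1) * (Pf + S (cj A))
  - 2%:R * II * fsubst (rc h) (pair2 X (II * X ^+ k)).
  have Sx : S (rc (fpsC kappa * x ^+ k.-1)) = fpsC (kappa%:C)%C * X ^+ k.-1.
    by rewrite [rc _]rmorphM rmorphM /= rcC S_C [rc _]rmorphXn rmorphXn /= rcx S_var.
  rewrite e !(rmorphB, rmorphD, rmorphM (subst segre_pt0)) /= Sx SA SB S_C Sh.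
  by rewrite (rmorph1 (subst segre_pt0)).
rewrite eS in h2.
have cB := conj_part hg1; have cA := conj_part hf1.
have cA' : vanish wd (N + k).+1 (II * fpsC (kappa%:C)%C * (X ^+ k.-1 *
    (S (cj A) - fpsC (conjc fc) * (2%:R * X - Z) ^+ N.+1))).
  apply: vanishMl; apply: (@vanishW _ _ _ (1 * k.-1 + N.+2)); first by lia.
  by apply: vanishM cA; apply: vanishX; apply: vanish_var.
have := vanishD h2 (vanishD cB cA'); congr (vanish _ _ _).
by rewrite -/gc -/B; ring.
Qed.

(** The coefficient of Z^i X^j in the equation on the Segre set. For i > 0 the right-hand side
    of the linearized equation, which became a series in X, does not contribute. *)
Lemma kernel_coef i j : (0 < i)%N -> (i + j = N + k)%N ->
  (if (k %| j)%N then g1 (mn2 i (j %/ k)) * (2%:R * 'i%C) ^+ (j %/ k) else 0)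
  - 'i%C * (kappa%:C)%C * (if (k.-1 <= j)%N then
     if (k %| j - k.-1)%N then f1 (mn2 i ((j - k.-1) %/ k)) * (2%:R * 'i%C) ^+ ((j - k.-1) %/ k) else 0
     else 0)
  = conjc gc * ('C(N + k, j)%:R * (-1) ^+ i * 2%:R ^+ j)
   + 'i%C * (kappa%:C)%C * (if (k.-1 <= j)%N then
       conjc fc * ('C(N.+1, j - k.-1)%:R * (-1) ^+ i * 2%:R ^+ (j - k.-1)) else 0).
Proof.
move=> i0 hij; have k0 : (0 < k)%N by lia.
have hm : (mwt wd (mn2 i j) < (N + k).+1)%N by rewrite mwt_deg mdeg2 hij.
have := complexified hm; rewrite -rmorphM.
have -> : 2%:R * X - Z = fpsC (-1) * Z + fpsC 2%:R * X.
  by rewrite rmorphN rmorph1 rmorph_nat; ring.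
have -> : 2%:R * II = fpsC (2%:R * 'i%C : C) :> fps 2 C.
  by rewrite rmorphM rmorph_nat.
rewrite !fpsBE fpsDE !fpsCM !var_u_mul /Pg /Pf !fsubst_power_coef // fsubst_diag_coef // mulr0 subr0.
rewrite binomial2_coef // => /eqP; rewrite subr_eq0 => /eqP ->.
congr (_ + _ * _); case: leqP => // h1.
rewrite fpsCM binomial2_coef //; lia.
Qed.

End Kernel.

(** * Solutions of the linearized equation *)

Section KernelConsequences.
Variables (R : realType) (k : nat).
Hypothesis hk : (2 < k)%N.
Notation C := R[i].
Notation w2 := (wt2 k).
Notation w3 := (wt3 k).
Notation x := (var px : fps 3 R).
Notation mp := (model_pt R k).
Notation II := (fpsC ('i%C : C)).

Variables (f1 g1 : fps 2 C) (h : fps 2 R) (kappa : R) (N : nat).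
Hypotheses (hN : (0 < N)%N) (hkappa : kappa != 0).
Hypotheses (hf1 : vanish w2 N.+1 f1) (hg1 : vanish w2 (N + k) g1).
Hypothesis hlin : vanish w3 (N + k).+1
  (im (fsubst g1 mp) - fpsC kappa * x ^+ k.-1 * re (fsubst f1 mp) - fsubst h (xu_pt R)).

Let coefs := kernel_coef hk hf1 hg1 hlin.

Let conjc_inj0 (c : C) : conjc c = 0 -> c = 0.
Proof. by move/eqP; rewrite conjc_eq0 => /eqP. Qed.
Let ikn0 : 'i%C * (kappa%:C)%C != 0 :> C.
Proof.
rewrite mulf_neq0 //; first by rewrite eq_complex /= negb_and oner_eq0 orbT.
by rewrite eq_complex /= negb_and hkappa.
Qed.
Let n1 i : (-1 : C) ^+ i != 0. Proof. by rewrite signr_eq0. Qed.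
Let n2 i : (2%:R : C) ^+ i != 0. Proof. by rewrite expf_neq0 // pnatr_eq0. Qed.
Let nbin n i : (i <= n)%N -> ('C(n, i)%:R : C) != 0.
Proof. by move=> hi; rewrite pnatr_eq0 -lt0n bin_gt0. Qed.

Let ndvd d : (0 < d < k)%N -> (k %| d)%N = false.
Proof. by move=> /andP[d0 dk]; apply/negP => /(dvdn_leq d0); lia. Qed.

(** The exponent j = 1 of X is neither 0 nor -1 modulo k, so the multiple of (2X - Z)^(N + k) is
    alone in this coefficient. *)
Lemma g_pure_z : g1 (mn2 (N + k) 0) = 0.
Proof.
have := coefs (i := (N + k).-1) (j := 1) _ _; rewrite ndvd; last by lia.
have -> : (k.-1 <= 1)%N = false by lia.
rewrite !mulr0 subr0 addr0 => e; apply: conjc_inj0; apply/eqP.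
have /esym/eqP := e ltac:(lia) ltac:(lia).
by rewrite !mulf_eq0 (negbTE (n1 _)) (negbTE (n2 _)) (negbTE (nbin _)) ?orbF //; lia.
Qed.

(** The exponent j = k + 1 is neither 0 nor -1 modulo k, so only the X^2 term of (2X - Z)^(N + 1),
    multiplied by X^(k-1), contributes. For N = 1 this coefficient has i = 0 and says nothing
    about f1. *)
Lemma f_pure_z : (1 < N)%N -> f1 (mn2 N.+1 0) = 0.
Proof.
move=> N1; have := coefs (i := N.-1) (j := k.+1) _ _.
have -> : (k %| k.+1)%N = false by rewrite -addn1 dvdn_addr // ndvd //; lia.
have -> : (k.-1 <= k.+1)%N by lia.
have -> : (k.+1 - k.-1 = 2)%N by lia.
rewrite ndvd; last by lia.
rewrite g_pure_z !raddf0 ?mul0r ?add0r ?mulr0 ?subr0 ?oppr0 => e.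
apply: conjc_inj0; apply/eqP.
have /esym/eqP := e ltac:(lia) ltac:(lia).
rewrite mulf_eq0 (negbTE ikn0) /= mulf_eq0.
by rewrite (negbTE (mulf_neq0 (mulf_neq0 (nbin _) (n1 _)) (n2 _))) ?orbF //; lia.
Qed.

(** Once the conjugate terms are gone, the terms of g1 and f1 cannot cancel each other: they sit
    at exponents of X congruent to 0 and to -1 modulo k. *)
Lemma mixed_terms : f1 (mn2 N.+1 0) = 0 ->
  (forall i j, (0 < i)%N -> (i + k * j = N + k)%N -> g1 (mn2 i j) = 0) /\
  (forall i j, (0 < i)%N -> (i + k * j = N.+1)%N -> f1 (mn2 i j) = 0).
Proof.
move=> f0; have k0 : (0 < k)%N by lia.
have ni j : (2%:R * 'i%C : C) ^+ j != 0.
  by rewrite expf_neq0 // mulf_neq0 ?pnatr_eq0 // eq_complex /= negb_and oner_eq0 orbT.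
split=> i j i0 hij.
  have := coefs i0 hij; rewrite g_pure_z f0 !raddf0 !mul0r.
  rewrite dvdn_mulr // mulKn //.
  have -> (a : C) : (if (k.-1 <= k * j)%N then if (k %| k * j - k.-1)%N then a else 0 else 0)
     = 0 :> C.
    case: ifP => // h1; case: ifP => // /dvdnP[t ht]; exfalso.
    have : (k * j = t * k + k.-1)%N by lia.
    by move/(congr1 (modn^~ k)); rewrite mulnC modnMl modnMDl modn_small; lia.
  rewrite if_same !mulr0 subr0 addr0 => /eqP.
  by rewrite mulf_eq0 (negbTE (ni _)) orbF => /eqP.
have := coefs (i := i) (j := k.-1 + k * j) i0 _; rewrite g_pure_z f0 !raddf0 !mul0r.
have -> : (k %| k.-1 + k * j)%N = false by rewrite dvdn_addl ?dvdn_mulr // ndvd //; lia.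
rewrite leq_addr addKn dvdn_mulr // mulKn // sub0r mulr0 addr0 => e.
have /eqP := e ltac:(lia); rewrite oppr_eq0 mulf_eq0 (negbTE ikn0) /=.
by rewrite mulf_eq0 (negbTE (ni _)) orbF => /eqP.
Qed.

(** The point with y = 0, with x and u as variables. *)
Definition slice_pt : 'I_2 -> fps 2 C := pair2 (var jx) (var ju + II * var jx ^+ k).

Lemma vanish_slice_pt i : vanish w2 (w2 i) (slice_pt i).
Proof.
elim/ord2P: i; rewrite /slice_pt ?(pair2x, pair2u).
  exact: (@vanish_var _ _ w2 jx).
apply: vanishD; first exact: (@vanish_var _ _ w2 ju).
apply: vanishMl; have := @vanishX _ C w2 _ _ k (@vanish_var _ _ w2 jx).
by rewrite /wt2 pair2x mul1n.
Qed.
Lemma slice_pt0 i : slice_pt i 0%MM = 0.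
Proof. exact: (vanish_pos (w2_gt0 hk i) (@vanish_slice_pt i)). Qed.

Lemma restricted : vanish w2 (N + k).+1
  (im (fsubst g1 slice_pt) - fpsC kappa * (var jx ^+ k.-1 * re (fsubst f1 slice_pt)) - h).
Proof.
pose s (i : 'I_3) : fps 2 R := if i == px then var jx else if i == py then 0 else var ju.
have vs i : vanish w2 (w3 i) (s i).
  elim/ord3P: i; rewrite /s /wt3 /=; [|exact: vanish0|].
    exact: (@vanish_var _ _ w2 jx).
  exact: (@vanish_var _ _ w2 ju).
have s0 i : s i 0%MM = 0.
  apply: (vanish_pos _ (@vs i)); elim/ord3P: i; rewrite /wt3 //=; lia.
have rs0 i : rc (s i) 0%MM = 0 by rewrite /rc /fps_map s0 raddf0.
have hs a : fsubst (fsubst a mp) (fun i => rc (s i)) = fsubst a slice_pt.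
  rewrite (fsubstA _ (@model_pt0 R k hk)) //; congr fsubst; apply: funext.
  pose phi := subst (b := fun i => rc (s i)) rs0.
  have ev i : phi (rc (var i)) = rc (s i).
    by rewrite varE rc_mon -varE -[LHS]/(fsubst _ _) fsubst_var.
  have eI : phi II = II by exact: fsubstC rs0 _.
  have eDM b c d : phi (b + c * d) = phi b + phi c * phi d by rewrite -rmorphM -rmorphD.
  have eX b n : phi (b ^+ n) = phi b ^+ n by rewrite -rmorphXn.
  have rv i : rc (var i : fps 2 R) = var i by rewrite varE rc_mon.
  apply: ord2P; rewrite /model_pt /slice_pt ?(pair2x, pair2u) -[LHS]/(phi _).
    by rewrite /zpt eDM !ev /s /= raddf0 rv mulr0 addr0.
  by rewrite /model_w [rc (_ ^+ _)]rmorphXn eDM eX !ev eI /s /= !rv.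
have hh : fsubst (fsubst h (xu_pt R)) s = h.
  rewrite (fsubstA _ (@xu0 R k hk) s0) -[RHS]fsubst_id; congr fsubst; apply: funext.
  by apply: ord2P; rewrite -[LHS]/(fsubst (var _) s) fsubst_var.
have := fsubst_vanish s0 vs hlin.
rewrite -[fsubst _ s]/(subst s0 _) !(rmorphB (subst s0), rmorphM (subst s0), rmorphXn (subst s0)) /= /subst.
by rewrite -!im_fsubst // -!re_fsubst // !hs hh fsubstC // fsubst_var // mulrA.
Qed.

Lemma slice_coef n i : (i <= n)%N ->
  (slice_pt ju ^+ n) (mn2 (k * i) (n - i)) = 'C(n, i)%:R * 'i%C ^+ i.
Proof.
move=> hi; have -> : slice_pt ju = fpsC 1 * mon U_(ju)%MM + II * mon (mn2 k 0).
  by rewrite /slice_pt pair2u mon2 expr0 mulr1 rmorph1 mul1r varE.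
have em : mn2 (k * i) (n - i) = (U_(ju)%MM *+ (n - i) + mn2 k 0 *+ i)%MM.
  apply/mnmP; apply: ord2P; rewrite mnmDE !mulmnE ?mn2_x ?mn2_u mnm1E /=.
    by rewrite mul0n add0n.
  by rewrite mul1n mul0n addn0.
rewrite (binomial_coef1 _ _ hi em) ?expr1n ?mulr1 // => t _.
move=> /(congr1 (fun m : 'X_{1..2} => m jx)); rewrite mn2_x mnmDE !mulmnE mn2_x mnm1E /= mul0n add0n.
by move/eqP; rewrite eqn_pmul2l; [move/eqP|lia].
Qed.

Hypothesis h_nf : forall l, [/\ h (mn2 0 l) = 0, h (mn2 k.-1 l) = 0, h (mn2 k l) = 0
  & h (mn2 (2 * k).-1 l) = 0].

Lemma pure_part d (a : fps 2 C) n : (k * n = d)%N -> vanish w2 d a ->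
  (forall i j, (0 < i)%N -> (i + k * j = d)%N -> a (mn2 i j) = 0) ->
  vanish w2 d.+1 (a - fpsC (a (mn2 0 n)) * var ju ^+ n).
Proof.
move=> hn ha hm; apply/vanish2P => i j; rewrite mul1n ltnS leq_eqVlt => /orP[/eqP e|e].
  have -> : var ju ^+ n = mon (mn2 0 n) :> fps 2 C by rewrite mon2 expr0 mul1r.
  rewrite fpsBE fpsCM monE mn2_eq.
  have [i0|i0] := posnP i.
    have -> : j = n by (subst i; nia).
    by rewrite i0 !eqxx /= mulr1 subrr.
  by rewrite hm //= mulr0 subrr.
rewrite fpsBE ha ?mwt2 ?mul1n // sub0r; apply/eqP; rewrite oppr_eq0; apply/eqP.
have hv : vanish w2 d (fpsC (a (mn2 0 n)) * var ju ^+ n).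
  apply: vanishMl; have := @vanishX _ C w2 _ _ n (@vanish_var _ _ w2 ju).
  by rewrite /wt2 pair2u hn.
by apply: hv; rewrite mwt2 mul1n.
Qed.

Lemma no_pure_part d (a : fps 2 C) : ~~ (k %| d)%N -> vanish w2 d a ->
  (forall i j, (0 < i)%N -> (i + k * j = d)%N -> a (mn2 i j) = 0) ->
  vanish w2 d.+1 a.
Proof.
move=> hn ha hm; apply/vanish2P => i j; rewrite mul1n ltnS leq_eqVlt => /orP[/eqP e|e].
  apply: hm => //; rewrite lt0n; apply: contraNneq hn => i0.
  by rewrite -e i0 add0n dvdn_mulr.
by apply: ha; rewrite mwt2 mul1n.
Qed.

Lemma fsubst_pure d (a : fps 2 C) n c : vanish w2 d (a - fpsC c * var ju ^+ n) ->
  vanish w2 d (fsubst a slice_pt - fpsC c * slice_pt ju ^+ n).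
Proof.
move=> /(fsubst_vanish slice_pt0 vanish_slice_pt).
by rewrite -[fsubst _ _]/(subst slice_pt0 _) rmorphB rmorphM rmorphXn /= /subst fsubstC ?fsubst_var //; exact: slice_pt0.
Qed.

(** At most one of the powers w^n of weight N + k in g1 and w^n of weight N + 1 in f1 exists. The
    real and imaginary parts of its coefficient appear, up to nonzero factors, as coefficients of
    h in X_k and X_0, respectively in X_(k-1) and X_(2k-1). *)
Lemma normal_form_step : f1 (mn2 N.+1 0) = 0 ->
  vanish w2 N.+2 f1 /\ vanish w2 (N + k).+1 g1.
Proof.
move=> fz; have [hg hf] := mixed_terms fz.
have coef m : (mwt w2 m = N + k)%N ->
    (im (fsubst g1 slice_pt) - fpsC kappa * (var jx ^+ k.-1 * re (fsubst f1 slice_pt))) m = h m.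
  move=> hm; apply/eqP; rewrite -subr_eq0 -fpsBE; apply/eqP/restricted.
  by rewrite hm.
have xpow q (a : fps 2 R) i j : (q <= i)%N -> (var jx ^+ q * a) (mn2 i j) = a (mn2 (i - q) j).
  move=> hq; have -> : var jx ^+ q = mon (mn2 q 0) :> fps 2 R by rewrite mon2 expr0 mulr1.
  have -> : mn2 i j = (mn2 q 0 + mn2 (i - q) j)%MM; last exact: mon_mulE.
  by apply/mnmP; apply: ord2P; rewrite mnmDE ?mn2_x ?mn2_u // subnKC.
have [/dvdnP[n hn]|hkg] := boolP (k %| N + k)%N.
  (* N + k and N + 1 cannot both be multiples of k. *)
  have hkf : ~~ (k %| N.+1)%N.
    apply/negP => h1; have : (k %| N)%N by rewrite -(dvdn_addl _ (dvdnn k)) hn dvdn_mull.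
    by move=> h2; move: h1; rewrite -addn1 dvdn_addr // ndvd //; lia.
  have vf := no_pure_part hkf hf1 hf; split=> //.
  have hn' : (k * n = N + k)%N by rewrite hn mulnC.
  have vg := pure_part hn' hg1 hg; have vq := im_vanish (fsubst_pure vg).
  set b := g1 (mn2 0 n) in vg vq.
  have vt : vanish w2 (N + k).+1 (fpsC kappa * (var jx ^+ k.-1 * re (fsubst f1 slice_pt))).
    apply: vanishMl; apply: (@vanishW _ _ _ (1 * k.-1 + N.+2)); first by lia.
    apply: vanishM; last exact/re_vanish/(fsubst_vanish slice_pt0 vanish_slice_pt).
    by apply: vanishX; apply: (@vanish_var _ _ w2 jx).
  have coef' i : (i <= n)%N -> complex.Im (b * ('C(n, i)%:R * 'i%C ^+ i)) = h (mn2 (k * i) (n - i)).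
    move=> hi; have hm : (mwt w2 (mn2 (k * i) (n - i)) = N + k)%N by rewrite mwt2; nia.
    have hm' : (mwt w2 (mn2 (k * i) (n - i)) < (N + k).+1)%N by rewrite hm.
    rewrite -coef // fpsBE vt // subr0; apply/eqP; rewrite -slice_coef // eq_sym -subr_eq0.
    have := vq _ hm'; rewrite raddfB /= fpsBE => /eqP.
    by rewrite /im fpsCM.
  have n1' : (0 < n)%N by nia.
  have := coef' 0%N isT; have := coef' 1%N n1'.
  rewrite muln0 muln1 subn0; have [-> _ _ _] := h_nf n; have [_ _ -> _] := h_nf (n - 1).
  rewrite bin0 bin1 expr0 !mulr1 expr1 => e1 e2.
  have b0 : b = 0.
    move: e1 e2; rewrite -[n%:R](rmorph_nat (real_complex R)); case: (b) => p q /=.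
    rewrite ?(mul0r, mulr0, mul1r, mulr1, subr0, sub0r, addr0, add0r, oppr0).
    by move=> /eqP; rewrite mulf_eq0 pnatr_eq0 (gtn_eqF n1') orbF => /eqP -> ->.
  by move: vg; rewrite b0 rmorph0 mul0r subr0.
have vg := no_pure_part hkg hg1 hg; split=> //.
have [/dvdnP[n hn]|hkf] := boolP (k %| N.+1)%N; last exact: no_pure_part hkf hf1 hf.
have hn' : (k * n = N.+1)%N by rewrite hn mulnC.
have vf := pure_part hn' hf1 hf; have vq := re_vanish (fsubst_pure vf).
set b := f1 (mn2 0 n) in vf vq.
(* The other case, with a power of w in f1 and none in g1. *)
have vt : vanish w2 (N + k).+1 (im (fsubst g1 slice_pt)).
  exact/im_vanish/(fsubst_vanish slice_pt0 vanish_slice_pt).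
have coef' i : (i <= n)%N ->
    - (kappa * complex.Re (b * ('C(n, i)%:R * 'i%C ^+ i))) = h (mn2 (k.-1 + k * i) (n - i)).
  move=> hi; have hm : (mwt w2 (mn2 (k.-1 + k * i) (n - i)) = N + k)%N by rewrite mwt2; nia.
  have hm' : (mwt w2 (mn2 (k.-1 + k * i) (n - i)) < (N + k).+1)%N by rewrite hm.
  rewrite -coef // fpsBE vt // sub0r fpsCM xpow ?leq_addr // addKn; congr (- (_ * _)).
  apply/eqP; rewrite -slice_coef // eq_sym -subr_eq0.
  have hw : (mwt w2 (mn2 (k * i) (n - i)) < N.+2)%N by rewrite mwt2; nia.
  have := vq _ hw; rewrite raddfB /= fpsBE => /eqP.
  by rewrite /re fpsCM.
have n1' : (0 < n)%N by nia.
have := coef' 0%N isT; have := coef' 1%N n1'.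
rewrite muln0 muln1 subn0 addn0; have [_ -> _ _] := h_nf n.
have -> : (k.-1 + k = (2 * k).-1)%N by lia.
have [_ _ _ ->] := h_nf (n - 1).
rewrite bin0 bin1 expr0 !mulr1 expr1 => /eqP; rewrite oppr_eq0 mulf_eq0 (negbTE hkappa) => /eqP e1.
move=> /eqP; rewrite oppr_eq0 mulf_eq0 (negbTE hkappa) => /eqP e2.
have b0 : b = 0.
  move: e1 e2; rewrite -[n%:R](rmorph_nat (real_complex R)); case: (b) => p q /=.
  rewrite ?(mul0r, mulr0, mul1r, mulr1, subr0, sub0r, addr0, add0r, oppr0).
  by move=> /eqP; rewrite oppr_eq0 mulf_eq0 pnatr_eq0 (gtn_eqF n1') orbF => /eqP -> ->.
by move: vf; rewrite b0 rmorph0 mul0r subr0.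
Qed.

(** For N = 1 the exponent j = k - 1 of X only involves the coefficient of z^2 and its conjugate, and
    j = k relates it to the coefficient of z w. Differentiated
    along i d/dz, the solutions are the real multiples of the dilation field z d/dz + k w d/dw
    of the model, up to the factor alpha in f and alpha^k in g. *)
Lemma first_step : N = 1%N ->
  f1 (mn2 2 0) = - conjc (f1 (mn2 2 0)) /\ g1 (mn2 1 1) = 2%:R * (kappa%:C)%C * f1 (mn2 2 0).
Proof.
move=> N1; set fc := f1 (mn2 2 0).
have gz := g_pure_z.
have e1 := coefs (i := 2) (j := k.-1) isT ltac:(lia).
have e2 := coefs (i := 1) (j := k) isT ltac:(lia).
move: e1 e2; rewrite gz N1 raddf0 !mul0r !add0r -/fc leqnn subnn dvdn0 div0n expr0 mulr1.
rewrite ndvd; last by lia.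
rewrite dvdnn divnn (_ : (0 < k)%N); last by lia.
rewrite leq_pred (_ : (k - k.-1 = 1)%N); last by lia.
rewrite ndvd; last by lia.
rewrite bin0 bin1 expr0 !mulr1 expr1 !expr1 mulr0 subr0 sub0r sqrrN expr1n mulr1.
move=> e1 e2.
have ef : fc = - conjc fc.
  apply: (mulfI ikn0); apply: oppr_inj; rewrite e1; ring.
split=> //.
have i0 : (2%:R * 'i%C : C) != 0.
  by rewrite mulf_neq0 ?pnatr_eq0 // eq_complex /= negb_and oner_eq0 orbT.
by apply: (mulIf i0); rewrite e2 [in RHS]ef; ring.
Qed.

End KernelConsequences.

(** * Eigenfunctions of vector fields *)

Section Euler.
Variables (K : numFieldType) (n : nat) (w : 'I_n -> nat).
Implicit Types (a r : fps n K) (t : 'I_n -> fps n K).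

Lemma euler_coef1 i a m : (var i * fps_deriv i a) m = a m *+ m i.
Proof.
have [mi|mi] := posnP (m i).
  rewrite mi mulr0n; apply: fpsME_eq0 => m1 m2 e; left.
  rewrite varE monE; case: eqP => // e1; move: mi.
  by rewrite e mnmDE e1 mnm1E eqxx.
have em : m = (U_(i) + (m - U_(i)))%MM.
  by rewrite addmC submK // lep1mP -lt0n.
rewrite em varE mon_mulE /fps_deriv -em.
have -> : (m - U_(i) + U_(i) = m)%MM by rewrite addmC -em.
by rewrite mnmBE mnm1E eqxx subn1 prednK.
Qed.

(** The Euler field lam (sum of w_i x_i d/dx_i), whose eigenfunctions are the weighted homogeneous
    series. *)
Definition euler (lam : K) (i : 'I_n) : fps n K := fpsC ((w i)%:R * lam) * var i.

Lemma along_euler lam a m : along (euler lam) a m = lam * (mwt w m)%:R * a m.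
Proof.
rewrite /along fps_sumE /mwt natr_sum mulr_sumr mulr_suml; apply: eq_bigr => i _.
by rewrite /euler -mulrA fpsCM euler_coef1 natrM -mulr_natl; ring.
Qed.

Variables (t : 'I_n -> fps n K) (lam : K) (omega : nat).
Hypothesis lam0 : lam != 0.
Hypothesis ht : forall i, vanish w (w i).+1 (t i - euler lam i).

Let raise N r : vanish w N r -> vanish w N.+1 (along t r - along (euler lam) r).
Proof.
move=> hr; have -> : along t r - along (euler lam) r = along (fun i => t i - euler lam i) r.
  by rewrite /along -sumrB; apply: eq_bigr => i _; rewrite mulrBl.
by rewrite -addn1; apply: along_vanish hr => i; rewrite addn1.
Qed.

Lemma natrB_neq0 (a b : nat) : a != b -> (a%:R - b%:R : K) != 0.
Proof. by move=> h; rewrite subr_eq0 eqr_nat. Qed.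

(** The lowest part of r, of weight N > omega, would be an eigenfunction of the Euler field for
    both lam N and lam omega. *)
Lemma eigen_zero r : vanish w omega.+1 r -> along t r = fpsC (omega%:R * lam) * r -> r = 0.
Proof.
move=> hr er; apply: (vanish_all (w := w)); elim=> // N IH.
have [hN|hN] := leqP N omega; first exact: vanishW hr.
move=> m; rewrite ltnS leq_eqVlt => /orP[/eqP hm|]; last exact: IH.
have hm' : (mwt w m < N.+1)%N by rewrite hm.
have := raise IH hm'; rewrite er fpsBE fpsCM along_euler hm => e.
have : (omega%:R - N%:R) * (lam * r m) = 0 by rewrite -e; ring.
move/eqP; rewrite !mulf_eq0 (negbTE lam0) /= (negbTE (natrB_neq0 _)) /=; last by rewrite ltn_eqF.
by move/eqP.
Qed.

(** Poincare-Dulac: the correction of weight N solves an equation with the factor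
    lam (N - omega), which is invertible for N > omega; the remaining terms raise the weight, so
    the correction is a fixed point. *)
Lemma eigen_exists i : w i = omega -> exists2 s, vanish w omega.+1 (s - var i) &
  along t s = fpsC (omega%:R * lam) * s.
Proof.
move=> wi; pose rho := t i - fpsC (omega%:R * lam) * var i.
have hrho : vanish w omega.+1 rho by have := @ht i; rewrite /euler wi.
pose F (r : fps n K) : fps n K := fun m => if (mwt w m <= omega)%N then 0 else
  - (rho + (along t r - along (euler lam) r)) m / (lam * ((mwt w m)%:R - omega%:R)).
have [|r hr] := @fps_fixpoint n K w F.
  move=> N a b hab m hm; rewrite fpsBE /F; case: ifP => h; first by rewrite subrr.
  rewrite -mulrBl; set A := _ - _; have -> : A = 0; last by rewrite mul0r.
  have := raise hab hm; rewrite !raddfB /= !(fpsBE, fpsDE, fpsNE) /A => e.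
  by rewrite !(fpsBE, fpsDE) -[RHS]oppr0 -e; ring.
have hv : vanish w omega.+1 r by move=> m; rewrite ltnS -hr /F => ->.
exists (var i + r); first by rewrite addrC addKr || rewrite addrAC subrr add0r.
apply/fpsP => m; apply/eqP; rewrite -subr_eq0; apply/eqP.
rewrite raddfD /= along_var fpsDE fpsCM fpsDE.
transitivity (rho m + (along t r - along (euler lam) r) m
   + lam * ((mwt w m)%:R - omega%:R) * r m).
  by rewrite /rho !fpsBE fpsCM along_euler; ring.
case: (leqP (mwt w m) omega) => h.
  rewrite hrho ?ltnS // (raise hv) ?hv ?ltnS //; last exact: leqW.
  by rewrite mulr0 !addr0.
rewrite -[in X in _ * X]hr /F leqNgt h /= mulrC divfK.
  by rewrite fpsDE addrN.
by rewrite mulf_neq0 // natrB_neq0 // gtn_eqF.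
Qed.
End Euler.

(** * The exceptional case: equivalence with the model *)

Lemma fps_compE n p (K : comNzRingType) (a : fps n K) (b : 'I_n -> fps p K) :
  fps_comp a b = fsubst a b.
Proof. by rewrite fsubst.unlock. Qed.

Section Equivalence.
Variables (R : realType) (k : nat).
Hypothesis hk : (2 < k)%N.
Notation C := R[i].
Notation w2 := (wt2 k).
Notation w3 := (wt3 k).
Notation x := (var px : fps 3 R).
Notation II := (fpsC ('i%C : C)).
Notation Dz := (fps_deriv jx).
Notation Dw := (fps_deriv ju).
Notation vz := (var jx : fps 2 C).
Notation vw := (var ju : fps 2 C).

(** The field a d/dz + b d/dw that maps to alpha d/dz in the target: Cramer's rule for
    f_z a + f_w b = alpha, g_z a + g_w b = 0. *)
Section Field.
Variables (f g : fps 2 C) (alpha lam : C).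
Hypothesis alpha0 : alpha != 0.
Hypothesis hf : vanish w2 3 (f - (fpsC alpha * vz + fpsC (- alpha * lam / 2%:R) * vz ^+ 2)).
Hypothesis hg : vanish w2 k.+2
  (g - (fpsC (alpha ^+ k) * vw + fpsC (- k%:R * alpha ^+ k * lam) * (vz * vw))).

Let der0 (i : 'I_2) (c : C) (a : fps 2 C) : fps_deriv i (fpsC c * a) = fpsC c * fps_deriv i a.
Proof. by rewrite derivM derivC mul0r add0r. Qed.
Let w2z : w2 jx = 1%N. Proof. by []. Qed.
Let w2w : w2 ju = k. Proof. by []. Qed.

Let hfz : vanish w2 2 (Dz f - (fpsC alpha - fpsC (alpha * lam) * vz)).
Proof.
have := deriv_vanish (i := jx) hf; rewrite w2z raddfB raddfD /= !der0 expr2 derivM !deriv_var /=.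
have e : fpsC (- alpha * lam / 2%:R) * (1 * vz + vz * 1) = - (fpsC (alpha * lam) * vz).
  transitivity (fpsC (- alpha * lam / 2%:R * 2%:R) * vz).
    by rewrite [in RHS](rmorphM fpsC) rmorph_nat; ring.
  by rewrite divfK ?pnatr_eq0 // mulNr rmorphN mulNr.
by rewrite mulr1n e mulr1.
Qed.

Let hgz : vanish w2 k.+1 (Dz g - fpsC (- k%:R * alpha ^+ k * lam) * vw).
Proof.
have := deriv_vanish (i := jx) hg; rewrite w2z subn1 raddfB raddfD /= !der0 derivM !deriv_var /=.
by congr (vanish _ _ (_ - _)); rewrite mulr0 mul1r; ring.
Qed.

Let hgw : vanish w2 1 (Dw g - fpsC (alpha ^+ k)).
Proof.
have := deriv_vanish (i := ju) hg; rewrite w2w raddfB raddfD /= !der0 derivM !deriv_var /=.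
rewrite mul0r add0r !mulr1 => h.
have -> : Dw g - fpsC (alpha ^+ k) = (Dw g - (fpsC (alpha ^+ k) + fpsC (- k%:R * alpha ^+ k * lam) * vz))
  + fpsC (- k%:R * alpha ^+ k * lam) * vz by ring.
apply: vanishD; first by apply: vanishW h; lia.
by apply: vanishMl; exact: (@vanish_var _ _ w2 jx).
Qed.

Let vgz : vanish w2 k (Dz g).
Proof.
rewrite -[Dz g](subrK (fpsC (- k%:R * alpha ^+ k * lam) * vw)).
apply: vanishD; first exact: vanishW hgz.
by apply: vanishMl; exact: (@vanish_var _ _ w2 ju).
Qed.

Lemma field_exists : exists a b : fps 2 C,
  [/\ Dz f * a + Dw f * b = fpsC alpha, Dz g * a + Dw g * b = 0,
      vanish w2 2 (a - (1 + fpsC lam * vz)) & vanish w2 k.+1 (b - fpsC (k%:R * lam) * vw)].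
Proof.
pose J := Dz f * Dw g - Dw f * Dz g.
have wpos := w2_gt0 hk.
have hJ : vanish w2 1 (J - fpsC (alpha ^+ k.+1)).
  have -> : J - fpsC (alpha ^+ k.+1) =
    (Dz f - fpsC alpha) * Dw g + fpsC alpha * (Dw g - fpsC (alpha ^+ k)) - Dw f * Dz g.
    by rewrite exprS rmorphM /J /=; ring.
  apply: vanishB; last by apply: vanishMl; apply: vanishW vgz; lia.
  apply: vanishD; last by apply: vanishMl.
  apply: vanishMr.
  have -> : Dz f - fpsC alpha = (Dz f - (fpsC alpha - fpsC (alpha * lam) * vz)) - fpsC (alpha * lam) * vz by ring.
  apply: vanishB; first exact: vanishW hfz.
  by apply: vanishMl; exact: (@vanish_var _ _ w2 jx).
have J0 : J 0%MM != 0.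
  have /eqP : (J - fpsC (alpha ^+ k.+1)) 0%MM = 0 by apply: (vanish_pos _ hJ).
  rewrite fpsBE fpsCE eqxx subr_eq0 => /eqP ->.
  by rewrite expf_neq0.
have [Ji hJi] := fps_inv J0.
pose a := fpsC alpha * Dw g * Ji; pose b := - (fpsC alpha * Dz g * Ji).
have eb : vanish w2 k b by apply/vanishN/vanishMr/vanishMl.
have e1 : Dz f * a + Dw f * b = fpsC alpha.
  by rewrite /a /b -[RHS]mulr1 -hJi /J; ring.
have e2 : Dz g * a + Dw g * b = 0 by rewrite /a /b; ring.
exists a, b; split=> //.
  have fz0 : Dz f 0%MM != 0.
    have /eqP : (Dz f - (fpsC alpha - fpsC (alpha * lam) * vz)) 0%MM = 0 by apply: (vanish_pos _ hfz).
    rewrite !(fpsBE, fpsDE) fpsCM var0 mulr0 fpsCE eqxx subr0 subr_eq0 => /eqP ->.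
    exact: alpha0.
  have [fi hfi] := fps_inv fz0.
  have -> : a - (1 + fpsC lam * vz) = fi * (Dz f * a - Dz f * (1 + fpsC lam * vz)).
    by rewrite -[LHS]mul1r -hfi; ring.
  apply: vanishMl; have -> : Dz f * a = fpsC alpha - Dw f * b by rewrite -e1; ring.
  have -> : fpsC alpha - Dw f * b - Dz f * (1 + fpsC lam * vz) =
   - (Dw f * b) - (Dz f - (fpsC alpha - fpsC (alpha * lam) * vz)) * (1 + fpsC lam * vz)
   + fpsC (alpha * lam) * fpsC lam * vz ^+ 2 by rewrite rmorphM /=; ring.
  apply: vanishD.
    apply: vanishB; last exact: vanishMr.
    by apply/vanishN/vanishMl; apply: vanishW eb; lia.
  by apply: vanishMl; exact: (@vanishX _ _ w2 1 _ 2 (@vanish_var _ _ w2 jx)).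
have -> : b - fpsC (k%:R * lam) * vw = Ji * (J * b - J * (fpsC (k%:R * lam) * vw)).
  by rewrite -[LHS]mul1r -hJi; ring.
apply: vanishMl.
have -> : J * b = - (fpsC alpha * Dz g) by rewrite /b -[in RHS](mulr1 (Dz g)) -hJi; ring.
have -> : - (fpsC alpha * Dz g) - J * (fpsC (k%:R * lam) * vw) =
  - (fpsC alpha * (Dz g - fpsC (- k%:R * alpha ^+ k * lam) * vw))
  - (J - fpsC (alpha ^+ k.+1)) * (fpsC (k%:R * lam) * vw).
  rewrite exprS !rmorphM rmorphN /=; ring.
apply: vanishB; first by apply/vanishN/vanishMl.
rewrite -(add1n k); apply: vanishM hJ _.
by apply: vanishMl; exact: (@vanish_var _ _ w2 ju).
Qed.
End Field.

Section Tangent.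
Variables (G G' : fps 2 R) (f g : fps 2 C) (alpha c : R).
Hypotheses (hG : weight_gt k G) (hG' : weight_gt k G').
Hypothesis alpha0 : alpha != 0.
Let al : C := (alpha%:C)%C.
Let lam : C := 'i%C * (c%:C)%C.
Hypothesis c0 : c != 0.
Hypothesis hf : vanish w2 3 (f - (fpsC al * vz + fpsC (- al * lam / 2%:R) * vz ^+ 2)).
Hypothesis hg : vanish w2 k.+2
  (g - (fpsC (al ^+ k) * vw + fpsC (- k%:R * al ^+ k * lam) * (vz * vw))).
Let M := pt (rhs k G).
Hypothesis E : im (fsubst g M) =
  fsubst (rhs k G') (pair2 (re (fsubst f M)) (re (fsubst g M))).

Let M0 i : M i 0%MM = 0. Proof. exact: (pt0 hk hG). Qed.
Let vM i : vanish w3 (w2 i) (M i). Proof. exact: (vanish_pt hk hG). Qed.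

Variables (a b : fps 2 C).
Hypothesis hfa : Dz f * a + Dw f * b = fpsC al.
Hypothesis hga : Dz g * a + Dw g * b = 0.
Hypothesis va : vanish w2 2 (a - (1 + fpsC lam * vz)).
Hypothesis vb : vanish w2 k.+1 (b - fpsC (k%:R * lam) * vw).

Let aM := fsubst a M.
Let bM := fsubst b M.

(** The real field on the hypersurface, in the coordinates x, y, u, that should be the restriction
    of Re (i (a d/dz + b d/dw)): its components are the prescribed derivatives of x, y and u. *)
Definition tangent (i : 'I_3) : fps 3 R :=
  if i == px then re (II * aM) else if i == py then im (II * aM) else re (II * bM).
Notation rt T := (fun i => rc (T i)).

Lemma along_rc (T : 'I_3 -> fps 3 R) r : along (rt T) (rc r) = rc (along T r).
Proof.
rewrite [LHS]rcE re_along im_along rc_re rc_im raddf0 raddf0 mulr0 addr0 //.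
Qed.

Lemma along_I (T : 'I_3 -> fps 3 R) r : along (rt T) (II * r) = II * along (rt T) r.
Proof. by rewrite alongM alongC mul0r add0r. Qed.

Let Q := fsubst (rhs k G) (xu_pt R).
(** The derivative of v along this field minus the value that tangency requires. *)
Let defect := along tangent Q - im (II * bM).

Let tz : along (rt tangent) (M jx) = II * aM.
Proof.
rewrite /M /pt pair2x /zpt raddfD /= along_I !along_rc !along_var /tangent /=.
by rewrite -rcE.
Qed.

Let tw : along (rt tangent) (M ju) = II * bM + II * rc defect.
Proof.
rewrite /M /pt pair2u /wpt raddfD /= along_I !along_rc along_var -/Q.
rewrite [II * bM]rcE /tangent /= /defect rmorphB /=; ring.
Qed.

Let chain (T : 'I_3 -> fps 3 C) (s : fps 2 C) :
  along T (fsubst s M) = fsubst (Dz s) M * along T (M jx) + fsubst (Dw s) M * along T (M ju).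
Proof. by rewrite along_fsubst // sum2. Qed.

Let substDM (s1 s2 s3 s4 : fps 2 C) :
  fsubst (s1 * s2 + s3 * s4) M = fsubst s1 M * fsubst s2 M + fsubst s3 M * fsubst s4 M.
Proof. by rewrite -[LHS]/(subst M0 _) rmorphD !rmorphM. Qed.

Let subst1 : fsubst 1 M = 1.
Proof. exact: rmorph1 (subst M0). Qed.

Let g0 : g 0%MM = 0.
Proof.
have : (g - (fpsC (al ^+ k) * vw + fpsC (- k%:R * al ^+ k * lam) * (vz * vw))) 0%MM = 0.
  exact: (vanish_pos _ hg).
rewrite fpsBE fpsDE !fpsCM var0 mulr0 add0r (_ : (vz * vw) 0%MM = 0) ?mulr0 ?subr0 //.
by rewrite -[LHS]/(cst_coef _) rmorphM /= {1}/cst_coef var0 mul0r.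
Qed.
Let f0 : f 0%MM = 0.
Proof.
have : (f - (fpsC al * vz + fpsC (- al * lam / 2%:R) * vz ^+ 2)) 0%MM = 0.
  exact: (vanish_pos _ hf).
rewrite fpsBE fpsDE !fpsCM var0 mulr0 add0r (_ : (vz ^+ 2) 0%MM = 0) ?mulr0 ?subr0 //.
by rewrite -[LHS]/(cst_coef _) rmorphXn /= {1}/cst_coef var0 expr0n.
Qed.

Let Dwg0 : Dw g 0%MM = al ^+ k.
Proof.
rewrite coef_deriv0.
have : (g - (fpsC (al ^+ k) * vw + fpsC (- k%:R * al ^+ k * lam) * (vz * vw))) U_(ju)%MM = 0.
  by apply: hg; rewrite mwtU /wt2 pair2u.
rewrite fpsBE fpsDE !fpsCM (_ : (vz * vw) U_(ju)%MM = 0); last first.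
  by rewrite mulrC -[vw]expr1 -mn2_01 var_u_mul subnn varE monE -mn2_10 mn2_eq.
rewrite varE monE eqxx mulr1 mulr0 addr0 => /eqP; rewrite subr_eq0 => /eqP //.
Qed.

(** Along the field f and g move by i alpha and 0, up to multiples of the defect. Differentiate
    Im g = Q'(Re f, Re g), which does not involve Im f: the contributions of i alpha cancel, and
    the defect is multiplied by a series with constant term alpha^k, a unit. *)
Lemma tangency : along (rt tangent) (M ju) = II * bM.
Proof.
suff r0 : defect = 0 by rewrite tw r0 raddf0 mulr0 addr0.
have tf : along (rt tangent) (fsubst f M) = II * fpsC al + rc defect * (II * fsubst (Dw f) M).
  rewrite chain tz tw.
  transitivity (II * fsubst (Dz f * a + Dw f * b) M + rc defect * (II * fsubst (Dw f) M)).
    by rewrite substDM -/aM -/bM; ring.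
  by rewrite hfa fsubstC.
have tg : along (rt tangent) (fsubst g M) = rc defect * (II * fsubst (Dw g) M).
  rewrite chain tz tw.
  transitivity (II * fsubst (Dz g * a + Dw g * b) M + rc defect * (II * fsubst (Dw g) M)).
    by rewrite substDM -/aM -/bM; ring.
  by rewrite hga -[fsubst 0 M]/(subst M0 _) raddf0 mulr0 add0r.
have tX : along tangent (re (fsubst f M)) = - (defect * im (fsubst (Dw f) M)).
  rewrite -re_along tf raddfD /= re_rcM !re_I im_C /= rmorph0 oppr0 add0r; ring.
have tU : along tangent (re (fsubst g M)) = - (defect * im (fsubst (Dw g) M)).
  rewrite -re_along tg re_rcM re_I; ring.
have tV : along tangent (im (fsubst g M)) = defect * re (fsubst (Dw g) M).
  by rewrite -im_along tg im_rcM im_I.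
pose s : 'I_2 -> fps 3 R := pair2 (re (fsubst f M)) (re (fsubst g M)).
have s0 i : s i 0%MM = 0.
  by elim/ord2P: i; rewrite /s ?(pair2x, pair2u) /re fsubst_cst // ?f0 ?g0.
pose B := re (fsubst (Dw g) M) + fsubst (fps_deriv jx (rhs k G')) s * im (fsubst (Dw f) M)
  + fsubst (fps_deriv ju (rhs k G')) s * im (fsubst (Dw g) M).
have eB : defect * B = 0.
  have := tV; rewrite E -/s along_fsubst // sum2 /s pair2x pair2u -/s tX tU => e.
  have : defect * re (fsubst (Dw g) M) - defect * re (fsubst (Dw g) M) = 0 by rewrite subrr.
  rewrite -{2}e /B => <-; ring.
(* The right-hand side has no linear terms, so only Re g_w contributes to B at the origin. *)
have dx0 : fps_deriv jx (rhs k G') 0%MM = 0.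
  rewrite coef_deriv0 rhsE fpsDE.
  have -> : var jx ^+ k = mon (mn2 k 0) :> fps 2 R by rewrite mon2 expr0 mulr1.
  rewrite -mn2_10 monE mn2_eq (_ : (1%N == k) = false) ?add0r; last by lia.
  by apply: (weight_vanish hk hG'); rewrite mwt2; lia.
have du0 : fps_deriv ju (rhs k G') 0%MM = 0.
  rewrite coef_deriv0 rhsE fpsDE.
  have -> : var jx ^+ k = mon (mn2 k 0) :> fps 2 R by rewrite mon2 expr0 mulr1.
  rewrite -mn2_01 monE mn2_eq andbF add0r.
  by apply: (weight_vanish hk hG'); rewrite mwt2; lia.
have B0 : B 0%MM != 0.
  rewrite -[B 0%MM]/(cst_coef B) /B !rmorphD !rmorphM /=.
  rewrite /cst_coef !(fsubst_cst _ s0) dx0 du0 !mul0r !addr0 /re fsubst_cst // Dwg0 -rmorphXn /=.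
  by rewrite expf_neq0.
have [Bi hBi] := fps_inv B0.
by rewrite -[defect]mulr1 -hBi mulrA eB mul0r.
Qed.

(** The field tangent and d/dy are both tangent to the hypersurface; their difference vanishes at
    the origin and has the linear part - c (x d/dx + y d/dy + k u d/du). *)
Definition tangent0 (i : 'I_3) : fps 3 R := tangent i - (py == i)%:R.

Let along_tangent0 r : along tangent0 r = along tangent r - fps_deriv py r.
Proof.
by rewrite deriv_along /along -sumrB; apply: eq_bigr => i _; rewrite mulrBl.
Qed.

Let dyQ : fps_deriv py Q = 0.
Proof.
rewrite /Q deriv_fsubst; last exact: (@xu0 R k hk).
by rewrite sum2 /xu_pt pair2x pair2u !deriv_var /= !mulr0 addr0.
Qed.

Let t0z : along (rt tangent0) (M jx) = II * fsubst (a - 1) M.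
Proof.
have -> : fsubst (a - 1) M = aM - 1.
  by rewrite fsubstB // subst1.
rewrite mulrBr -tz mulr1 /M /pt pair2x /zpt !raddfD /= !along_I !along_rc !along_tangent0.
rewrite !deriv_var /= !rmorphB /= ?mulr0n ?mulr1n ?raddf0 rmorph1; ring.
Qed.

Let t0w : along (rt tangent0) (M ju) = II * bM.
Proof.
rewrite -tangency /M /pt pair2u /wpt !raddfD /= !along_I !along_rc !along_tangent0 -/Q dyQ.
by rewrite deriv_var /= !subr0.
Qed.

Definition linear_field : 'I_2 -> fps 2 C := pair2 (a - 1) b.

Lemma along_pullback s : along (rt tangent0) (fsubst s M) = II * fsubst (along linear_field s) M.
Proof.
rewrite chain t0z t0w /along sum2 /linear_field pair2x pair2u.
have -> : fsubst ((a - 1) * Dz s + b * Dw s) M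
  = fsubst (a - 1) M * fsubst (Dz s) M + bM * fsubst (Dw s) M by rewrite substDM.
ring.
Qed.

Let lamE : 'i%C * lam = - (c%:C)%C.
Proof. by rewrite /lam mulrA -expr2 sqr_i mulN1r. Qed.

(** Since lam is imaginary, i times the eigenvalue is real, and the real field acts on the real
    and imaginary parts separately. *)
Lemma eigen_pullback s n : along linear_field s = fpsC (n%:R * lam) * s ->
  along tangent0 (re (fsubst s M)) = fpsC (n%:R * - c) * re (fsubst s M) /\
  along tangent0 (im (fsubst s M)) = fpsC (n%:R * - c) * im (fsubst s M).
Proof.
move=> es; have e : along (rt tangent0) (fsubst s M) = rc (fpsC (n%:R * - c)) * fsubst s M.
  rewrite along_pullback es fsubstM // fsubstC // mulrA -rmorphM rcC; congr (fpsC _ * _).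
  by rewrite mulrCA lamE rmorphM rmorph_nat rmorphN.
by rewrite -re_along -im_along e re_rcM im_rcM.
Qed.

Let vaM : vanish w3 2 (fsubst (a - 1) M - fpsC lam * zpt R).
Proof.
have -> : fsubst (a - 1) M - fpsC lam * zpt R = fsubst (a - (1 + fpsC lam * vz)) M.
  have -> : a - (1 + fpsC lam * vz) = a - 1 - fpsC lam * vz by ring.
  by rewrite fsubstB // fsubstM // fsubstC // fsubst_var.
exact: (fsubst_vanish M0 vM va).
Qed.
Let vbM : vanish w3 k.+1 (bM - fpsC (k%:R * lam) * M ju).
Proof.
have := fsubst_vanish M0 vM vb.
by rewrite fsubstB // fsubstM // fsubstC // fsubst_var.
Qed.

Lemma tangent0_euler i : vanish w3 (w3 i).+1 (tangent0 i - euler w3 (- c) i).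
Proof.
have h1 := vanishMl II vaM; have h2 := vanishMl II vbM.
have tI : II * fpsC lam = rc (fpsC (- c)) :> fps 3 C by rewrite -rmorphM lamE rcC; congr fpsC; rewrite rmorphN.
have e1 : II * aM = II * fsubst (a - 1) M + II.
  by rewrite fsubstB // subst1 -/aM; ring.
elim/ord3P: i; rewrite /tangent0 /tangent /euler /wt3 /=.
- rewrite subr0 e1 raddfD /= re_C /= raddf0 addr0 mul1r.
  have := re_vanish h1; rewrite mulrBr mulrA tI raddfB /= re_rcM /zpt reE.
  by [].
- rewrite e1 raddfD /= im_C /= rmorph1 addrK mul1r.
  have := im_vanish h1; rewrite mulrBr mulrA tI raddfB /= im_rcM /zpt imE.
  by [].
rewrite subr0.
have tI' : II * fpsC (k%:R * lam) = rc (fpsC (k%:R * - c)) :> fps 3 C.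
  by rewrite -rmorphM mulrCA lamE rcC; congr fpsC; rewrite rmorphM rmorph_nat rmorphN.
have := re_vanish h2; rewrite mulrBr mulrA tI' raddfB /= re_rcM /M /pt pair2u /wpt reE.
by [].
Qed.

Lemma linear_field_euler i : vanish w2 (w2 i).+1 (linear_field i - euler w2 lam i).
Proof.
elim/ord2P: i; rewrite /linear_field /euler /wt2 ?(pair2x, pair2u) //.
by have := va; rewrite mul1r; congr (vanish _ _ _); ring.
Qed.

Let lam0 : lam != 0.
Proof.
rewrite mulf_neq0 //; first by rewrite eq_complex /= negb_and oner_eq0 orbT.
by rewrite eq_complex /= negb_and c0.
Qed.

(** Let Z, W be the eigenfunctions z + ..., w + .... On the hypersurface Im W - (Re Z)^k has order
    above k and is an eigenfunction of the tangent field for the eigenvalue of weight k, so it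
    vanishes: (Z, W) maps the hypersurface to the model. *)
Lemma linearized : equivalent (rhs k G) (rhs k (fun=> 0)).
Proof.
have [sz vsz esz] := eigen_exists lam0 linear_field_euler (i := jx) erefl.
have [sw vsw esw] := eigen_exists lam0 linear_field_euler (i := ju) erefl.
pose Phi : fmap2 R := pair2 sz sw.
have uPhi : unipotent w2 Phi by move=> i; elim/ord2P: i.
have Phi0 := unipotent0 (w2_gt0 hk) uPhi.
have [L [L0 e1 e2]] := unipotent_inverse (w2_gt0 hk) uPhi.
exists Phi; split.
- exact: Phi0.
- exists L; split.
  + exact: L0.
  + by move=> i; apply/fpsP; rewrite fps_varE -e1 fsubst.unlock.
  + by move=> i; apply/fpsP; rewrite fps_varE -e2 fsubst.unlock.
have [ezr _] := eigen_pullback esz; have [_ ewi] := eigen_pullback esw.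
set X := re (fsubst sz M) in ezr; set V := im (fsubst sw M) in ewi.
have vX : vanish w3 2 (X - x).
  have := re_vanish (fsubst_vanish M0 vM vsz).
  by rewrite fsubstB // fsubst_var // raddfB /= /M /pt pair2x /zpt reE.
have vV : vanish w3 k.+1 (V - (x ^+ k + fsubst G (xu_pt R))).
  have := im_vanish (fsubst_vanish M0 vM vsw).
  rewrite fsubstB // fsubst_var // raddfB /= (_ : im (M ju) = x ^+ k + fsubst G (xu_pt R)) //.
  by rewrite /M /pt pair2u /wpt imE (rhs_xu hk).
have vX1 : vanish w3 1 X.
  rewrite -[X](subrK x); apply: vanishD; first exact: vanishW vX.
  exact: (@vanish_x R k).
have VX : V - X ^+ k = 0.
  apply: (@eigen_zero R 3 w3 tangent0 (- c) k _ tangent0_euler).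
  - by rewrite oppr_eq0.
  - have -> : V - X ^+ k = (V - (x ^+ k + fsubst G (xu_pt R))) + fsubst G (xu_pt R) - (X ^+ k - x ^+ k) by ring.
    apply: vanishB; first by apply: vanishD vV _; exact: (vanish_Gxu hk hG).
    have [] := @vanish_prod _ R w3 1 _ (fun=> 1%N) [:: tt] (fun=> k) (fun=> X) (fun=> x) => //.
      by move=> _; apply: (@vanish_x R k).
    by rewrite !big_seq1 mul1n addn1.
  rewrite raddfB /= ewi alongX ezr mulrBr; congr (_ - _).
  have -> : fpsC (1%:R * - c) = fpsC (- c) :> fps 3 R by rewrite mul1r.
  have -> : fpsC (k%:R * - c) = k%:R * fpsC (- c) :> fps 3 R by rewrite rmorphM rmorph_nat.
  have -> : X ^+ k = X ^+ k.-1 * X.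
    by rewrite -exprSr (_ : k.-1.+1 = k) //; lia.
  ring.
rewrite /takes /=; apply/fpsP; rewrite generic_pointE !fps_compE.
have X0 : X 0%MM = 0 by apply: (vanish_pos _ vX1).
have U0 : re (fsubst sw M) 0%MM = 0.
  by rewrite /re fsubst_cst // -[sw]/(Phi ju) Phi0.
have -> : fps_Im (fsubst (Phi iw) M) = V by [].
have -> : fps_Re (fsubst (Phi iz) M) = X by [].
rewrite fsubst_rhs; last by move=> i; elim/ord2P: i.
rewrite pair2x -[fun=> 0]/(0 : fps 2 R).
have b0 : forall i, pair2 X (fps_Re (fsubst (Phi iw) M)) i 0%MM = 0 by move=> i; elim/ord2P: i.
rewrite -[fsubst 0 _]/(subst b0 _) raddf0 addr0.
by apply/eqP; rewrite -subr_eq0 VX.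
Qed.
End Tangent.
End Equivalence.

(** * Rigidity *)

Section Rigidity.
Variables (R : realType) (k : nat).
Hypothesis hk : (2 < k)%N.
Notation C := R[i].
Notation w2 := (wt2 k).
Notation vz := (var jx : fps 2 C).
Notation vw := (var ju : fps 2 C).
Variables (G G' : fps 2 R) (f1 g1 : fps 2 C) (alpha : R).
Hypotheses (hG : weight_gt k G) (hGn : normal_form k G).
Hypotheses (hG' : weight_gt k G') (hGn' : normal_form k G').
Hypothesis alpha0 : alpha != 0.
Hypotheses (hf1 : vanish w2 2 f1) (hg1 : vanish w2 k.+1 g1).
Let M := pt (rhs k G).
Let f := fpsC (alpha%:C)%C * vz + f1.
Let g := fpsC ((alpha ^+ k)%:C)%C * vw + g1.
Hypothesis E : im (fsubst g M) =
  fsubst (rhs k G') (pair2 (re (fsubst f M)) (re (fsubst g M))).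

Let kappa := k%:R * alpha ^+ k.-1.
Let kappa0 : kappa != 0.
Proof. by rewrite mulf_neq0 ?expf_neq0 // pnatr_eq0; lia. Qed.

Let h_nf l : let h := hdiff k alpha G G' in
  [/\ h (mn2 0 l) = 0, h (mn2 k.-1 l) = 0, h (mn2 k l) = 0 & h (mn2 (2 * k).-1 l) = 0].
Proof.
have hd j : G (mn2 j l) = 0 -> G' (mn2 j l) = 0 -> hdiff k alpha G G' (mn2 j l) = 0.
  by move=> e e'; rewrite /hdiff fpsBE fsubst_scale_coef fpsCM e e' mul0r mulr0 subrr.
by case: hGn hGn' => [a1 a2 a3 a4] [b1 b2 b3 b4]; 
  split; apply: hd; [exact: a1|exact: b1|exact: a2|exact: b2|exact: a3|exact: b3|exact: a4|exact: b4].
Qed.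

Lemma rigid_tail : f1 (mn2 2 0) = 0 -> f1 = 0 /\ g1 = 0.
Proof.
move=> phi0.
have main N : vanish w2 N.+2 f1 /\ vanish w2 (N.+1 + k) g1.
  elim: N => [|N [IHf IHg]]; first by rewrite add1n.
  have hlin := linearize hk hG hG' (isT : (0 < N.+1)%N) IHf IHg E.
  have [] := normal_form_step hk (isT : (0 < N.+1)%N) kappa0 IHf IHg hlin h_nf.
    by case: N IHf IHg hlin => [|N] // IHf IHg hlin; apply: (f_pure_z hk _ kappa0 IHf IHg hlin).
  by rewrite addSn.
split; apply: (vanish_all (w := w2)) => N; have [h1 h2] := main N.
  by apply: vanishW h1; lia.
by apply: vanishW h2; lia.
Qed.

(** The imaginary coefficient phi of z^2 is written as - alpha (i c) / 2, which makes i c the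
    eigenvalue of the field that vanishes at the origin. *)
Lemma quadratic_equivalent : f1 (mn2 2 0) != 0 -> equivalent (rhs k G) (rhs k (fun=> 0)).
Proof.
set phi := f1 (mn2 2 0) => phi0.
have hg1' : vanish w2 (1 + k) g1 by rewrite add1n.
have hlin := linearize hk hG hG' (isT : (0 < 1)%N) hf1 hg1' E.
have [ephi eg] := first_step hk (isT : (0 < 1)%N) kappa0 hf1 hg1' hlin erefl.
have gz := g_pure_z hk (isT : (0 < 1)%N) kappa0 hf1 hg1' hlin.
rewrite -/phi in ephi eg.
(* Solve - alpha (i c) / 2 = phi = i s for c. *)
pose s := complex.Im phi; pose c := - (2%:R * s / alpha).
have es : phi = 'i%C * (s%:C)%C.
  move: ephi; rewrite /s; case: (phi) => p q /= /eqP; rewrite eq_complex /= => /andP[/eqP e _].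
  have -> : p = 0 by lra.
  by rewrite /= -[RHS]/(Complex _ _) ?(mul0r, mulr0, mul1r, subr0, sub0r, addr0, add0r, oppr0).
have s0 : s != 0 by apply: contraNneq phi0 => e; rewrite es e rmorph0 mulr0.
have al0 : ((alpha%:C)%C : C) != 0 by rewrite eq_complex /= negb_and alpha0.
have e1 : - (alpha%:C)%C * ('i%C * (c%:C)%C) / 2%:R = phi :> C.
  rewrite es /c rmorphN rmorphM fmorphV rmorphM rmorph_nat /=; field.
  exact: al0.
have e2 : - k%:R * ((alpha%:C)%C) ^+ k * ('i%C * (c%:C)%C) = 2%:R * (kappa%:C)%C * phi :> C.
  have -> : ((alpha%:C)%C) ^+ k = (alpha%:C)%C * ((alpha%:C)%C) ^+ k.-1 :> C.
    by rewrite -exprS prednK //; lia.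
  rewrite /kappa rmorphM rmorph_nat rmorphXn /= -e1; by field.
have hf : vanish w2 3 (f - (fpsC (alpha%:C)%C * vz + fpsC phi * vz ^+ 2)).
  have -> : f - (fpsC (alpha%:C)%C * vz + fpsC phi * vz ^+ 2) = f1 - fpsC phi * vz ^+ 2.
    by rewrite /f; ring.
  have -> : vz ^+ 2 = mon (mn2 2 0) by rewrite mon2 expr0 mulr1.
  apply/vanish2P => i j h; have -> : j = 0%N by nia.
  rewrite fpsBE fpsCM monE mn2_eq andbT.
  case: eqP => [->|hi]; first by rewrite mulr1 subrr.
  rewrite mulr0 subr0; apply: hf1; rewrite mwt2; lia.
have hg : vanish w2 k.+2 (g - (fpsC ((alpha ^+ k)%:C)%C * vw
    + fpsC (2%:R * (kappa%:C)%C * phi) * (vz * vw))).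
  rewrite -eg.
  have -> : g - (fpsC ((alpha ^+ k)%:C)%C * vw + fpsC (g1 (mn2 1 1)) * (vz * vw))
    = g1 - fpsC (g1 (mn2 1 1)) * (vz * vw) by rewrite /g; ring.
  have -> : vz * vw = mon (mn2 1 1) by rewrite mon2 !expr1.
  apply/vanish2P => i j h.
  rewrite fpsBE fpsCM monE mn2_eq.
  have [hlow|hhigh] := ltnP (i + k * j) k.+1.
    rewrite hg1 ?mwt2 ?mul1n // sub0r.
    case: eqP => [ei|]; last by rewrite mulr0 oppr0.
    case: eqP => [ej|]; last by rewrite mulr0 oppr0.
    by exfalso; subst i j; lia.
  have hs : (i + k * j = k.+1)%N by lia.
  have [j0|j0] := posnP j.
    have -> : i = (1 + k)%N by subst j; lia.
    rewrite j0 gz andbF mulr0 subrr //.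
  have j1 : j = 1%N.
    by case: j hs {h hhigh} j0 => [|[|j]] // hs _; exfalso; move: hs; rewrite !mulnS; lia.
  have -> : i = 1%N by subst j; lia.
  rewrite j1.
  by rewrite !eqxx mulr1 subrr.
have c0 : c != 0 by rewrite /c oppr_eq0 !mulf_neq0 ?pnatr_eq0 ?invr_eq0.
rewrite -e1 in hf; rewrite -e2 rmorphXn /= in hg.
have [a [b [ha hb va vb]]] := field_exists hk al0 hf hg.
exact: (linearized hk hG hG' alpha0 c0 hf hg E ha hb va vb).
Qed.
End Rigidity.

Theorem proposition7p2 (R : realType) (k : nat) (hk : (2 < k)%N)
  (G G' : fps 2 R) (Psi : fmap2 R)
  (hG : weight_gt k G) (hGn : normal_form k G)
  (hG' : weight_gt k G') (hGn' : normal_form k G')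
  (hPsi0 : fixes_origin Psi) (hPsi : invertible_map Psi)
  (htakes : takes Psi (rhs k G) (rhs k G'))
  (hfield : equivalent (rhs k G) (rhs k (fun=> 0)) -> respects_dy Psi) :
  exists delta : R, delta != 0 /\ forall i, Psi i =1 dilation k delta i.
Proof.
have E : im (fsubst (Psi iw) (pt (rhs k G))) = fsubst (rhs k G')
    (pair2 (re (fsubst (Psi iz) (pt (rhs k G)))) (re (fsubst (Psi iw) (pt (rhs k G))))).
  by move: htakes; rewrite /takes /= => /fpsP; rewrite generic_pointE !fps_compE.
have [Phi [Phi0 PsiPhi _]] := hPsi.
have lin := @invertible_linear R[i] Psi Phi Phi0.
have {}lin := lin (fun i => _ : fsubst (Psi i) Phi = var i).
have {}lin : Psi iw U_(jx)%MM = 0 -> Psi iz U_(jx)%MM != 0 /\ Psi iw U_(ju)%MM != 0.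
  by apply: lin => i; have /fpsP := PsiPhi i; rewrite fps_compE fps_varE.
have hG0 l : G' (mn2 0 l) = 0 by case: hGn' => h _ _ _; apply: h.
have [alpha alpha0 [hf hg]] := leading_terms hk hG hG' hG0 (hPsi0 iz) (hPsi0 iw) E
  (fun h => (lin h).1) (fun h => (lin h).2).
set f1 := Psi iz - _ in hf; set g1 := Psi iw - _ in hg.
have ef : Psi iz = fpsC (alpha%:C)%C * var jx + f1 by rewrite /f1; ring.
have eg : Psi iw = fpsC ((alpha ^+ k)%:C)%C * var ju + g1 by rewrite /g1; ring.
rewrite ef eg in E.
have phi0 : f1 (mn2 2 0) = 0.
  apply/eqP; apply/negPn/negP => phi0.
  have [c [hc _]] := hfield (quadratic_equivalent hk hG hG' alpha0 hf hg E phi0).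
  (* The coefficient of z in f_z is twice the coefficient of z^2 in f. *)
  have := hc U_(jx)%MM; rewrite /fps_deriv /fps_const mnm1_eq0 mnm1E eqxx => /eqP.
  rewrite mulrn_eq0 /= => /eqP e; move/eqP: phi0; apply.
  have -> : mn2 2 0 = (U_(jx) + U_(jx))%MM by rewrite /mn2 mulm0n addm0.
  rewrite /f1 fpsBE [Psi iz _]e fpsCM varE monE.
  rewrite -mn2_10 (_ : (mn2 1 0 + mn2 1 0)%MM = mn2 2 0) ?mn2_eq ?mulr0 ?subr0 //.
  by apply/mnmP; apply: ord2P; rewrite mnmDE ?mn2_x ?mn2_u.
have [f10 g10] := rigid_tail hk hG hGn hG' hGn' alpha0 hf hg E phi0.
exists alpha; split=> //.
apply: ord2P => m; rewrite /dilation ?(pair2x, pair2u) /fps_scale.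
  by rewrite ef f10 addr0 fpsCM fps_varE.
by rewrite eg g10 addr0 fpsCM fps_varE.
Qed.
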